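(* Let $\gamma\in(0,1)$, $p>1$, $A>0$ and $u_0>0$. Let $T_b$ be the blow-up time of the solution of $D_c^{\gamma}u=Au^p$, $u(0)=u_0$. Then $$\left(\frac{\Gamma(1+\gamma)}{Au_0^{p-1}G(p)}\right)^{1/\gamma}\le T_b\le\left(\frac{\Gamma(1+\gamma)}{Au_0^{p-1}H(p,\gamma)}\right)^{1/\gamma},$$ where $$G(p)=\min\left(2^p,\frac{p^p}{(p-1)^{p-1}}\right),\qquad H(p,\gamma)=\max\left(p-1,\,2^{-\frac{p\gamma}{p-1}}\right).$$ Consequently, with $A>0$ and $p>1$ fixed, there exist $u_{02}>u_{01}>0$ such that $\lim_{\gamma\to0^+}T_b=\infty$ whenever $0<u_0<u_{01}$, while $\lim_{\gamma\to0^+}T_b=0$ whenever $u_0>u_{02}$ (here $T_b$ is viewed as a function of $\gamma$ for fixed $A,p,u_0$).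
   Context: Fix $\gamma\in(0,1)$. A function $u\in L^1_{loc}(0,T)$ has right limit $u(0+)=u_0$ at $t=0$ if $\lim_{t\to0+}\frac1t\int_0^t|u(s)-u_0|\,ds=0$. For such $u$, the (generalized) Caputo derivative is the distribution on $(-\infty,T)$ supported in $[0,T)$ given by $D_c^{\gamma}u=g_{-\gamma}*\big((u-u(0+))\theta(t)\big)$, where $\theta$ is the Heaviside function and $g_{-\gamma}=\frac{1}{\Gamma(1-\gamma)}D\big(\theta(t)t^{-\gamma}\big)$ with $D$ the distributional derivative. A strong solution of $D_c^\gamma u=f(u)$, $u(0)=u_0$, is such a $u$ with $u(0+)=u_0$, $D_c^{\gamma}u\in L^1(0,T)$, satisfying the equation almost everywhere. It is known that for continuous $u$ the problem is equivalent to the Volterra equation $u(t)=u_0+\frac{1}{\Gamma(\gamma)}\int_0^t(t-s)^{\gamma-1}f(u(s))\,ds$. For $f(u)=Au^p$ on $(0,\infty)$ and $u_0>0$ there is a unique continuous strong solution on a maximal interval $[0,T_b)$; for $A>0,p>1$ one has $T_b<\infty$ and $\lim_{t\to T_b^-}u(t)=\infty$, and $T_b$ is called the blow-up time. *)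

(* Defs.v *)
From HB Require Import structures.
From mathcomp Require Import all_boot all_order all_algebra.
From mathcomp Require Import all_classical all_reals all_analysis.

Set Implicit Arguments.
Unset Strict Implicit.
Unset Printing Implicit Defensive.

Import Order.TTheory GRing.Theory Num.Theory.
Import numFieldNormedType.Exports.

Local Open Scope classical_set_scope.
Local Open Scope ring_scope.

Section Defs.
Context {R : realType}.
Local Notation mu := (@lebesgue_measure R).

(* Meaningful for x > 0 only. *)
Definition Gamma (x : R) : R :=
  \int[mu]_(t in `]0, +oo[) (t `^ (x - 1) * expR (- t)).

(* The test functions on ]-oo, T[: smooth, with compact support in ]-oo, T[. *)
Definition test_function (T : R) (phi : R -> R) : Prop :=
  (forall n x, derivable (derive1n n phi) x 1) /\
  (exists a b : R, b < T /\ forall x, phi x != 0 -> a <= x <= b).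

(* Distributions are represented by their action on test functions; their
   values on other functions are irrelevant. *)
Definition distribution_action := (R -> R) -> R.

Definition regular_distr (D : set R) (f : R -> R) : distribution_action :=
  fun phi => \int[mu]_(x in D) (f x * phi x).

Definition distr_derive (S : distribution_action) : distribution_action :=
  fun phi => - S (derive1 phi).

Definition heaviside (t : R) : R := (0 <= t)%R%:R.

Definition g_neg (gamma : R) : distribution_action :=
  fun phi => (Gamma (1 - gamma))^-1 *
    distr_derive (regular_distr setT (fun t => heaviside t * t `^ (- gamma))) phi.

(* The convolution S * w on ]-oo, T[ of a distribution S supported in
   [0, +oo[ with a function w on ]-oo, T[ that vanishes on ]-oo, 0[ and is
   integrable on [0, T'] for each T' < T, by the usual formula
   <S * w, phi> = \int w(s) <S, phi(. + s)> ds.  The test function phi(. + s)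
   has its support in ]-oo, T - s[, so the integrand vanishes for s close
   to T. *)
Definition conv_distr (T : R) (S : distribution_action) (w : R -> R) :
    distribution_action :=
  fun phi => \int[mu]_(s in `]-oo, T[) (w s * S (fun x => phi (x + s))).

(* u(0+) = u0.  The integral is extended-real valued, so that the convergence
   forces u to be integrable near 0. *)
Definition has_right_limit (u : R -> R) (u0 : R) : Prop :=
  ((t^-1)%:E * \int[mu]_(s in `]0%R, t[) `|u s - u0|%:E)%E @[t --> 0^'+]
    --> 0%E.

(* The Caputo derivative on ]-oo, T[ of a function u with u(0+) = u0. *)
Definition caputo (gamma T u0 : R) (u : R -> R) : distribution_action :=
  conv_distr T (g_neg gamma) (fun t => (u t - u0) * heaviside t).

Definition strong_solution (gamma : R) (f : R -> R) (u0 T : R) (u : R -> R) :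
    Prop :=
  [/\ locally_integrable `]0, T[ u,
      has_right_limit u u0 &
      exists h : R -> R,
        [/\ mu.-integrable `]0, T[ (EFin \o h),
            (forall phi, test_function T phi ->
               caputo gamma T u0 u phi = regular_distr `]0, T[ h phi) &
            {ae mu, forall t, t \in `]0, T[ -> h t = f (u t)}]].

(* A continuous strong solution on [0, T[ of D_c^gamma u = A u^p with values
   in ]0, +oo[, the domain of the nonlinearity.  The Caputo derivative is
   required to be integrable on ]0, T'[ for each T' < T only: for the maximal
   solution, u^p need not be integrable up to the blow-up time. *)
Definition power_solution (gamma A p u0 T : R) (u : R -> R) : Prop :=
  [/\ {within `[0, T[, continuous u},
      (forall t, 0 <= t < T -> 0 < u t) &
      forall T', 0 < T' < T ->
        strong_solution gamma (fun x => A * x `^ p) u0 T' u].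

Definition maximal_power_solution (gamma A p u0 T : R) (u : R -> R) : Prop :=
  power_solution gamma A p u0 T u /\
  ~ (exists T' v, [/\ T < T', power_solution gamma A p u0 T' v &
                      forall t, 0 <= t < T -> v t = u t]).

Definition blow_up_time (gamma A p u0 Tb : R) : Prop :=
  0 < Tb /\
  exists u : R -> R, maximal_power_solution gamma A p u0 Tb u /\
    u t @[t --> Tb^'-] --> +oo.

Definition G_const (p : R) : R :=
  Num.min (2 `^ p) (p `^ p / (p - 1) `^ (p - 1)).

Definition H_const (p gamma : R) : R :=
  Num.max (p - 1) (2 `^ (- (p * gamma / (p - 1)))).

End Defs.

(* Main.v *)
Require Import Defs.
From HB Require Import structures.
From mathcomp Require Import all_boot all_order all_algebra.
From mathcomp Require Import all_classical all_reals all_analysis.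
From mathcomp Require Import measurable_realfun ring lra.
Import Order.TTheory GRing.Theory Num.Theory.
Import numFieldNormedType.Exports.
Local Open Scope classical_set_scope.
Local Open Scope ring_scope.

Set Implicit Arguments.
Unset Strict Implicit.
Unset Printing Implicit Defensive.

(** Why the theorem holds.

    Volterra form.  Let K_a (t) = t^(a - 1) for t > 0, let * be convolution and
    f = A u^p.  The equation says that the distributional derivative of
    K_(1-gamma) * (u - u0) / Gamma (1 - gamma) is f.  Test it against smooth ramps
    x |-> E_n (t - x), where E_n (y) = exp (- 1 / (n y)) for y > 0 has derivative
    rho_n: for t in the interval of existence,
      u * K_(1-gamma) * rho_n
        = u0 * K_(1-gamma) * rho_n + Gamma (1 - gamma) f * E_n   ([caputo_test_fun]).
    All functions here are nonnegative, so convolution is associative by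
    Tonelli's theorem ([convA]) without any integrability.  Convolve with
    K_gamma.  The Beta integral K_gamma * K_(1-gamma) = Gamma gamma
    Gamma (1 - gamma) K_1 ([conv_kern]) and K_1 * rho_n = E_n give
      Gamma gamma (u * E_n) = Gamma gamma (u0 * E_n) + f * K_gamma * E_n.
    As n grows E_n increases to K_1: u and u0 + f * K_gamma / Gamma gamma have the
    same primitive ([integrated_volterra]).  Both are continuous, so
      u t = u0 + c int_0^t u(s)^p (t - s)^(gamma - 1) ds,  c = A / Gamma gamma
    ([power_solution_volterra]).  Put C = c / gamma = A / Gamma (1 + gamma).

    Lower bound ([blow_up_ge]).  While u <= M one has u t <= u0 + C M^p t^gamma.
    A continuous solution that blows up must reach every level M > u0, so
    M - u0 <= C M^p Tb^gamma.  The levels 2 u0 and p u0 / (p - 1) give the two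
    terms of G.

    Upper bounds.  The term 2^(- p gamma / (p - 1)) of H comes from an iteration
    ([blow_up_le_doubling]): the solution grows by a fixed factor on each of the
    intervals between the times S (1 - 2^-n), so it cannot exist beyond S.  The
    term p - 1 comes from a comparison ([blow_up_le_barrier]).  The solution v of
    v' = c t^(gamma - 1) v^p is increasing, and against an increasing function the
    kernel (t - s)^(gamma - 1) weighs at least as much as s^(gamma - 1).  So v is
    a subsolution of the Volterra equation, u stays above v if it starts above v,
    and the explicit blow-up time of v bounds Tb.

    Limits.  Since exp (- 1) <= Gamma (1 + gamma) <= 2 and
    H >= 2^(- p / (p - 1)), there is a threshold for u0, independent of gamma, below
    which Tb >= 2^(1 / gamma), and another above which Tb <= 2^(- 1 / gamma). *)

(** * Affine changes of variable *)

Section AffineChange.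
Context {R : realType}.
Local Notation mu := (@lebesgue_measure R).
Local Open Scope ereal_scope.

Let affine (a b : R) (x : measurableTypeR R) : measurableTypeR R := (a * (x : R) + b)%R.

Let measurable_affine a b : measurable_fun setT (affine a b).
Proof.
by apply: measurable_funD => //; apply: measurable_funM.
Qed.

(** The instance is named explicitly because it depends on a proof that the map
    is measurable, which unification cannot supply. *)
Let image_measure a b : {measure set (measurableTypeR R) -> \bar R} :=
  measure_function_pushforward__canonical__measure_function_Measure
    mu (measurable_affine a b).

Let affine_measure (a b : R) (a0 : a != 0%R) (A : set R) : measurable A ->
  mu A = mscale (`|a|%:nng)%R (image_measure a b) A.
Proof.
apply: lebesgue_measure_unique => //= _ [[c d]] _ <-.
rewrite /mscale/= /image_measure /pushforward/=.
have [a_gt0|a_le0] := ltP 0%R a.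
  have -> : affine a b @^-1` `]c, d]%classic
      = `]((c - b) / a)%R, ((d - b) / a)%R]%classic.
    apply/seteqP; split=> x /=; rewrite !in_itv/= /affine;
    by rewrite ltr_pdivrMr// ler_pdivlMr// lerBrDr ltrBlDr mulrC.
  rewrite !lebesgue_measure_itv/= !lte_fin ltr_pM2r ?invr_gt0// ltrD2r.
  case: ifPn => _; last by rewrite mule0.
  by rewrite -!EFinD -EFinM gtr0_norm//; congr (_ %:E); field.
have a_lt0 : (a < 0)%R by rewrite lt_neqAle a0.
have -> : affine a b @^-1` `]c, d]%classic
    = `[((d - b) / a)%R, ((c - b) / a)%R[%classic.
  apply/seteqP; split=> x /=; rewrite !in_itv/= /affine;
  by rewrite ltr_ndivlMr// ler_ndivrMr// lerBrDr ltrBlDr mulrC andbC.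
rewrite !lebesgue_measure_itv/= !lte_fin ltr_nM2r ?invr_lt0// ltrD2r.
case: ifPn => _; last by rewrite mule0.
by rewrite -!EFinD -EFinM ltr0_norm//; congr (_ %:E); field.
Qed.

Lemma ge0_integral_affine (a b : R) (f : R -> \bar R) : a != 0%R ->
  measurable_fun setT f -> (forall x, 0 <= f x) ->
  \int[mu]_x f x = (`|a|%R)%:E * \int[mu]_x f (a * (x : R) + b)%R.
Proof.
move=> a0 mf f0.
transitivity (\int[mscale (`|a|%:nng)%R (image_measure a b)]_x f x).
  by apply: eq_measure_integral => //= A mA _; exact: affine_measure.
rewrite ge0_integral_mscale//; congr (_ * _).
by rewrite (ge0_integral_pushforward (measurable_affine a b))//.
Qed.

End AffineChange.

(** * Convolution of nonnegative functions *)

Section Convolution.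
Context {R : realType}.
Local Notation mu := (@lebesgue_measure R).
Local Open Scope ereal_scope.
Implicit Types f g h : R -> \bar R.

Definition conv f g (t : R) : \bar R := \int[mu]_s (f s * g (t - s)%R).

(** The setting in which Tonelli's theorem needs no integrability. *)
Definition nnm f := measurable_fun setT f /\ forall x, 0 <= f x.

Let measurable_conv2 f g : nnm f -> nnm g ->
  measurable_fun setT (fun z : R * R => f z.2 * g (z.1 - z.2)%R).
Proof.
move=> [mf f0] [mg g0]; apply: emeasurable_funM.
  by apply: (measurableT_comp mf); exact: measurable_snd.
apply: (measurableT_comp mg).
apply: measurable_funB; [exact: measurable_fst|exact: measurable_snd].
Qed.

Lemma nnm_conv f g : nnm f -> nnm g -> nnm (conv f g).
Proof.
move=> mf mg; have m2 := measurable_conv2 mf mg.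
split; last by move=> t; apply: integral_ge0 => s _; rewrite mule_ge0 ?mf.2 ?mg.2.
apply: (measurable_fun_fubini_tonelli_F (m2 := mu) _ m2).
by move=> z; rewrite mule_ge0 ?mf.2 ?mg.2.
Qed.

Lemma nnm_shift f (c : R) : nnm f -> measurable_fun setT (fun s : R => f (c - s)%R).
Proof. by move=> [mf _]; apply: (measurableT_comp mf); apply: measurable_funB. Qed.

Lemma measurable_conv_integrand f g (t : R) : nnm f -> nnm g ->
  measurable_fun setT (fun s : R => f s * g (t - s)%R).
Proof.
by move=> mf mg; apply: emeasurable_funM; [exact: mf.1|exact: nnm_shift].
Qed.

Lemma convC f g : nnm f -> nnm g -> conv f g = conv g f.
Proof.
move=> mf mg; apply/funext => t; rewrite /conv.
rewrite (@ge0_integral_affine R (-1)%R t)//; last 2 first.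
- exact: measurable_conv_integrand.
- by move=> x; rewrite mule_ge0 ?mf.2 ?mg.2.
rewrite normrN1 mul1e; apply: eq_integral => s _.
by rewrite muleC; congr (g _ * f _); lra.
Qed.

(** Tonelli's theorem, after the change of variable s := s + r in the inner
    integral. *)
Lemma convA f g h : nnm f -> nnm g -> nnm h ->
  conv (conv f g) h = conv f (conv g h).
Proof.
move=> mf mg mh; apply/funext => t; rewrite /conv.
have m2 := measurable_conv2 mf mg.
have ge0 a b c (x y z : R) : nnm a -> nnm b -> nnm c -> 0 <= a x * b y * c z.
  by move=> ma mb mc; rewrite !mule_ge0 ?ma.2 ?mb.2 ?mc.2.
transitivity (\int[mu]_s \int[mu]_r (f r * g (s - r)%R * h (t - s)%R)).
  apply: eq_integral => s _; rewrite ge0_integralZr ?mh.2//.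
    exact: measurable_conv_integrand.
  by move=> r _; rewrite mule_ge0 ?mf.2 ?mg.2.
rewrite (@fubini_tonelli _ _ _ _ _ mu mu (fun z : R * R => f z.2 * g (z.1 - z.2)%R * h (t - z.1)%R)) /=.
- apply: eq_integral => r _.
  rewrite -ge0_integralZl ?mf.2//; last 2 first.
  + exact: measurable_conv_integrand.
  + by move=> s _; rewrite mule_ge0 ?mg.2 ?mh.2.
  rewrite (@ge0_integral_affine R 1%R r)//; last 2 first.
  + apply: emeasurable_funM; last exact: nnm_shift.
    apply: emeasurable_funM => //.
    by apply: (measurableT_comp mg.1); apply: measurable_funB.
  + by move=> x; exact: ge0.
  rewrite normr1 mul1e; apply: eq_integral => s _.
  rewrite -muleA; congr (_ * (g _ * h _)); lra.
- apply: emeasurable_funM => //; apply: (measurableT_comp mh.1).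
  by apply: measurable_funB => //; exact: measurable_fst.
- by move=> z; exact: ge0.
Qed.

Lemma convDl f g h : nnm f -> nnm g -> nnm h ->
  conv (f \+ g) h = conv f h \+ conv g h.
Proof.
move=> mf mg mh; apply/funext => t; rewrite /conv/=.
rewrite -ge0_integralD//.
- by apply: eq_integral => s _; rewrite ge0_muleDl ?mf.2 ?mg.2.
- by move=> s _; rewrite mule_ge0 ?mf.2 ?mh.2.
- exact: measurable_conv_integrand.
- by move=> s _; rewrite mule_ge0 ?mg.2 ?mh.2.
- exact: measurable_conv_integrand.
Qed.

Lemma convZl (c : R) f g : (0 <= c)%R -> nnm f -> nnm g ->
  conv (fun x => c%:E * f x) g = (fun t => c%:E * conv f g t).
Proof.
move=> c0 mf mg; apply/funext => t; rewrite /conv/= -ge0_integralZl//.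
- by apply: eq_integral => s _; rewrite muleA.
- exact: measurable_conv_integrand.
- by move=> s _; rewrite mule_ge0 ?mf.2 ?mg.2.
Qed.

Lemma nnmZ (c : R) f : (0 <= c)%R -> nnm f -> nnm (fun x => c%:E * f x).
Proof.
move=> c0 mf; split; last by move=> x; rewrite mule_ge0 ?mf.2 ?lee_fin.
by apply: emeasurable_funM => //; exact: mf.1.
Qed.

(** Monotone convergence.  The values of f are finite so that multiplication by
    them is continuous even where the limit is infinite. *)
Lemma cvg_conv f (g_ : nat -> R -> \bar R) g (t : R) : nnm f ->
  (forall x, f x \is a fin_num) -> (forall n, nnm (g_ n)) ->
  (forall x, {homo g_^~ x : n m / (n <= m)%N >-> n <= m}) ->
  (forall x, g_ n x @[n --> \oo] --> g x) ->
  conv f (g_ n) t @[n --> \oo] --> conv f g t.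
Proof.
move=> mf ff mg ndg gg.
have -> : conv f g t = \int[mu]_s limn (fun n => f s * g_ n (t - s)%R).
  apply: eq_integral => s _; apply/esym/cvg_lim => //.
  by apply: cvgeZl.
apply: cvg_monotone_convergence => //.
- by move=> n; exact: measurable_conv_integrand.
- by move=> n s _; rewrite mule_ge0 ?mf.2 ?(mg n).2.
- by move=> s _ n m nm; apply: lee_wpmul2l; [exact: mf.2|exact: ndg].
Qed.

End Convolution.

(** * The fundamental theorem for an integrand singular at the left end *)

Section ImproperFTC.
Context {R : realType}.
Local Notation mu := (@lebesgue_measure R).

(** The formula holds on [a + e, b] for each e > 0 and passes to the limit by
    monotone convergence. *)
Lemma ge0_FTC2_oc (f F : R -> R) (a b l : R) : a < b ->
  (forall x, a < x <= b -> 0 <= f x) ->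
  (forall x, a < x <= b -> {for x, continuous f}) ->
  (forall x, a < x <= b -> is_derive x 1 F (f x)) ->
  F x @[x --> a^'+] --> l ->
  (\int[mu]_(x in `]a, b]) (f x)%:E = (F b - l)%:E)%E.
Proof.
move=> ab f0 cf dF Fa.
pose e_ n : R := (b - a) / n.+2%:R.
have e_gt0 n : 0 < e_ n by rewrite divr_gt0// subr_gt0.
have e_lt n : e_ n < b - a.
  by rewrite ltr_pdivrMr// ltr_pMr ?subr_gt0// ltr1n.
have e_cvg : e_ n @[n --> \oo] --> (0 : R).
  rewrite -[X in _ --> X](mulr0 (b - a)); apply: cvgMr.
  by have := @cvg_harmonic R; rewrite -(@cvg_shiftS R^o (@harmonic R)).
pose I n := `[a + e_ n, b]%classic.
have Iab n x : I n x -> a < x <= b.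
  by rewrite /I/= in_itv/= => /andP[ax ->]; rewrite (lt_le_trans _ ax) ?ltrDl.
have bigI : \bigcup_n I n = `]a, b]%classic.
  apply/seteqP; split=> x /=; first by move=> [n _ /Iab]; rewrite in_itv.
  rewrite in_itv/= => /andP[ax xb].
  have /cvgrPdist_lt/(_ (x - a)) := e_cvg.
  rewrite subr_gt0 => /(_ ax)[N _ /(_ N (leqnn _))] /=.
  rewrite sub0r normrN gtr0_norm// => eN.
  by exists N => //; rewrite /I/= in_itv/= xb andbT; lra.
have cI n : {within I n, continuous f}.
  by apply: continuous_in_subspaceT => x /set_mem/Iab; exact: cf.
have mf n : measurable_fun (I n) (EFin \o f).
  apply/measurable_EFinP; apply: subspace_continuous_measurable_fun => //.
  by rewrite /I; exact: measurable_itv.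
have := @ge0_nondecreasing_set_cvg_integral _ (measurableTypeR R) R I (EFin \o f) mu _ _ mf _.
rewrite bigI => H.
have {}H : (\int[mu]_(x in I i) (EFin \o f) x @[i --> \oo] -->
    \int[mu]_(x in `]a, b]) (EFin \o f) x)%E.
  apply: H => //.
  - apply/nondecreasing_seqP => n; rewrite subsetEset => x.
    rewrite /I/= !in_itv/= => /andP[ex ->]; rewrite andbT.
    rewrite (le_trans _ ex)// lerD2l ler_pM2l ?subr_gt0//.
    by rewrite lef_pV2 ?posrE// ler_nat.
  - by move=> i; exact: measurable_itv.
  - by move=> i x /Iab abx; rewrite lee_fin f0.
rewrite -(cvg_lim _ H)//; apply/cvg_lim => //.
have IE n : (\int[mu]_(x in I n) (EFin \o f) x = (F b - F (a + e_ n)%R)%:E)%E.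
  have aen : a + e_ n < b by have := e_lt n; lra.
  rewrite EFinB; apply: continuous_FTC2 => //; first exact: (cI n).
  - have cF x : a < x <= b -> {for x, continuous F}.
      by move=> /dF [dFx _]; apply: differentiable_continuous; exact/derivable1_diffP.
    split.
    + move=> x; rewrite in_itv/= => /andP[x1 x2].
      have /dF[//] : a < x <= b by have := e_gt0 n; lra.
    + by apply: cvg_at_right_filter; apply: cF; have := e_gt0 n; lra.
    + by apply: cvg_at_left_filter; apply: cF; rewrite ab lexx.
  - move=> x; rewrite in_itv/= => /andP[x1 x2].
    have /dF[_ <-] : a < x <= b by have := e_gt0 n; lra.
    by rewrite derive1E.
under eq_fun do rewrite IE.
apply: cvg_EFin; first by near=> n.
apply: cvgB; first exact: cvg_cst.
move/cvg_at_rightP : Fa; apply; split.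
  by move=> n; rewrite ltrDl.
by rewrite -[X in _ --> X]addr0; apply: cvgD => //; exact: cvg_cst.
Unshelve. all: by end_near. Qed.

Lemma integral_powRB1 (a x : R) : 0 < a -> 0 < x ->
  (\int[mu]_(s in `]0%R, x]) (s `^ (a - 1))%:E = (x `^ a / a)%:E)%E.
Proof.
move=> a0 x0.
transitivity ((a^-1 * x `^ a - 0)%:E)%E; last by rewrite subr0 mulrC.
apply: (@ge0_FTC2_oc _ (fun s => a^-1 * s `^ a)) => //.
- by move=> s _; rewrite powR_ge0.
- move=> s /andP[s0 _]; apply: differentiable_continuous.
  by apply/derivable1_diffP; apply: derivable_powR; rewrite in_itv/= s0.
- move=> s /andP[s0 _].
  have /(is_deriveZ a^-1) := @is_derive1_powR R a s s0.
  by rewrite /GRing.scale/= mulrA mulVf ?mul1r// gt_eqF.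
- rewrite -[X in _ --> X](mulr0 a^-1); apply: cvgMr.
  exact: powR_cvg0.
Qed.

End ImproperFTC.

(** * The kernels t^(a - 1), the Gamma function and the Beta integral *)

Section Kernels.
Context {R : realType}.
Local Notation mu := (@lebesgue_measure R).
Local Open Scope ereal_scope.
Implicit Types (f g : R -> \bar R) (a b t x : R).

(** Divided by Gamma a, this is the kernel of the Riemann-Liouville integral of
    order a. *)
Definition kern a x : \bar R := (if (0 < x)%R then x `^ (a - 1) else 0%R)%:E.

(** The Laplace transform at the point 1, whose value on kern a is Gamma a. *)
Definition laplace1 f : \bar R := \int[mu]_s (f s * (expR (- s))%:E).

Lemma kern_gt0 a x : (0 < x)%R -> kern a x = (x `^ (a - 1))%:E.
Proof. by move=> x0; rewrite /kern x0. Qed.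

Lemma kern_le0 a x : (x <= 0)%R -> kern a x = 0.
Proof. by move=> x0; rewrite /kern ltNge x0. Qed.

Lemma nnm_kern a : nnm (kern a).
Proof.
split; last by move=> x; rewrite lee_fin; case: ifP => // _; exact: powR_ge0.
apply/measurable_EFinP; apply: measurable_fun_ifT => //.
exact: measurable_fun_ltr.
Qed.

Let nnm_exp : nnm (fun x => (expR x)%:E : \bar R).
Proof.
split; last by move=> x; rewrite lee_fin expR_ge0.
by apply/measurable_EFinP; exact: measurable_expR.
Qed.

Let measurable_laplace f : nnm f ->
  measurable_fun setT (fun s : R => f s * (expR (- s))%:E).
Proof.
move=> mf; apply: emeasurable_funM; first exact: mf.1.
by apply/measurable_EFinP; apply: measurableT_comp.
Qed.

Let conv_exp f t : nnm f -> conv f (EFin \o expR) t = (expR t)%:E * laplace1 f.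
Proof.
move=> mf; rewrite /conv /laplace1 -ge0_integralZl ?lee_fin ?expR_ge0//.
- by apply: eq_integral => s _; rewrite /= expRD EFinM muleCA.
- exact: measurable_laplace mf.
- by move=> s _; rewrite mule_ge0 ?mf.2// lee_fin expR_ge0.
Qed.

Lemma laplace1_ge0 f : nnm f -> 0 <= laplace1 f.
Proof.
by move=> mf; apply: integral_ge0 => s _; rewrite mule_ge0 ?mf.2// lee_fin expR_ge0.
Qed.

(** The Laplace transform at 1 is the convolution with the exponential,
    evaluated at 0, so that associativity makes it multiplicative. *)
Lemma laplace1_conv f g : nnm f -> nnm g ->
  laplace1 (conv f g) = laplace1 f * laplace1 g.
Proof.
move=> mf mg.
transitivity (conv (conv f g) (EFin \o expR) 0%R).
  by rewrite conv_exp ?expR0 ?mul1e//; exact: nnm_conv.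
rewrite convA// [LHS](_ : _ = conv f (fun t => laplace1 g * (expR t)%:E) 0%R).
  rewrite {1}/conv.
  under eq_integral do rewrite sub0r [laplace1 g * _]muleC muleA.
  rewrite ge0_integralZr//.
  - exact: measurable_laplace mf.
  - by move=> s _; rewrite mule_ge0 ?mf.2// lee_fin expR_ge0.
  - exact: laplace1_ge0.
congr (conv f _ _); apply/funext => t.
by rewrite conv_exp// muleC.
Qed.

Lemma laplace1Z (c : \bar R) f : 0 <= c -> nnm f ->
  laplace1 (fun x => c * f x) = c * laplace1 f.
Proof.
move=> c0 mf; rewrite /laplace1 -ge0_integralZl//.
- by apply: eq_integral => s _; rewrite muleA.
- exact: measurable_laplace mf.
- by move=> s _; rewrite mule_ge0 ?mf.2// lee_fin expR_ge0.
Qed.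

Lemma conv_kern_le0 a b t : (t <= 0)%R -> conv (kern a) (kern b) t = 0.
Proof.
move=> t0; apply: integral0_eq => s _.
have [s0|s0] := leP s 0%R; first by rewrite kern_le0 ?mul0e.
by rewrite [X in _ * X]kern_le0 ?mule0//; lra.
Qed.

(** Substitute s = t r in the convolution integral. *)
Lemma conv_kern_scale a b t :
  conv (kern a) (kern b) t = conv (kern a) (kern b) 1 * kern (a + b) t.
Proof.
have [t0|t0] := leP t 0%R; first by rewrite conv_kern_le0 ?kern_le0 ?mule0.
rewrite {1}/conv (@ge0_integral_affine R t 0%R) ?gt_eqF//; last 2 first.
- by apply: measurable_conv_integrand; exact: nnm_kern.
- by move=> x; rewrite mule_ge0 ?(nnm_kern _).2.
rewrite /conv -ge0_integralZr//; last 3 first.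
- by apply: measurable_conv_integrand; exact: nnm_kern.
- by move=> x _; rewrite mule_ge0 ?(nnm_kern _).2.
- exact: (nnm_kern _).2.
rewrite -ge0_integralZl//; last 2 first.
- apply: emeasurable_funM.
    apply: (measurableT_comp (nnm_kern _).1).
    by apply: measurable_funD => //; exact: measurable_funM.
  apply: (measurableT_comp (nnm_kern _).1).
  apply: measurable_funB => //.
  by apply: measurable_funD => //; exact: measurable_funM.
- by move=> x _; rewrite mule_ge0 ?(nnm_kern _).2.
apply: eq_integral => s _; rewrite addr0.
have -> : (t - t * s = t * (1 - s))%R by ring.
have [s0|s0] := leP s 0%R.
  rewrite kern_le0; first by rewrite (kern_le0 _ s0) !mul0e mule0.
  by rewrite mulr_ge0_le0// ltW.
have [s1|s1] := leP 1%R s.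
  rewrite (@kern_le0 b); last by rewrite mulr_ge0_le0 ?(ltW t0) ?subr_le0.
  by rewrite (@kern_le0 b (1 - s)) ?mule0 ?mul0e//; lra.
rewrite !kern_gt0 ?mulr_gt0 ?subr_gt0//.
rewrite !powRM ?subr_ge0 ?(ltW t0) ?(ltW s0) ?(ltW s1)// -!EFinM gtr0_norm//.
congr (_ %:E).
have -> : (t `^ (a + b - 1) = t * t `^ (a - 1) * t `^ (b - 1))%R.
  rewrite -[X in (X * _ * _)%R]powRr1 ?(ltW t0)// -!powRD ?(gt_eqF t0) ?implybT//.
  by congr (_ `^ _)%R; ring.
ring.
Qed.

Lemma conv_kern_causal b f t : (forall s, (s <= 0)%R -> f s = 0) ->
  conv f (kern b) t = \int[mu]_(s in `]0%R, t[) (f s * ((t - s) `^ (b - 1))%:E).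
Proof.
move=> f0; rewrite [RHS]integral_mkcond; apply: eq_integral => s _.
rewrite patchE; case: ifPn; rewrite ?inE ?notin_setE /= in_itv/=.
  by move=> /andP[s0 st]; rewrite kern_gt0 ?subr_gt0.
move=> /negP; rewrite negb_and -!leNgt => /orP[s0|ts]; first by rewrite f0 ?mul0e.
by rewrite kern_le0 ?mule0 ?subr_le0.
Qed.

Lemma conv_kern1_causal f t : (forall s, (s <= 0)%R -> f s = 0) ->
  conv f (kern 1) t = \int[mu]_(s in `]0%R, t[) f s.
Proof.
move=> f0; rewrite conv_kern_causal//; apply: eq_integral => s _.
by rewrite subrr powRr0 mule1.
Qed.

Lemma conv_kern1 a t : (0 < a)%R -> (0 < t)%R ->
  conv (kern a) (kern 1) t = (t `^ a / a)%:E.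
Proof.
move=> a0 t0; rewrite -integral_powRB1// -[RHS]integral_itv_bndo_bndc//; last first.
  by apply/measurable_EFinP; apply: measurable_funTS; exact: measurable_powR.
rewrite conv_kern1_causal; last by move=> s; exact: kern_le0.
by apply: eq_integral => s; rewrite inE/= in_itv/= => /andP[s0 _]; rewrite kern_gt0.
Qed.

Lemma conv_kern1E a : (0 < a)%R ->
  conv (kern a) (kern 1) = (fun t => (a^-1)%:E * kern (a + 1) t).
Proof.
move=> a0; apply/funext => t; rewrite conv_kern_scale conv_kern1//.
by rewrite powR1 div1r.
Qed.

Lemma laplace1_kern1 : laplace1 (kern 1) = 1.
Proof.
rewrite -(@integral_exponential_pdf R 1%R)//.
apply: ae_eq_integral => //.
- exact: measurable_laplace (nnm_kern _).
- by apply/measurable_EFinP; exact: measurable_exponential_pdf.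
exists [set 0%R]; split => //; first exact: lebesgue_measure_set1.
move=> s /=; apply: contra_notP => /eqP s0 _.
rewrite /exponential_pdf patchE; case: ifPn; rewrite ?inE ?notin_setE /= in_itv/= andbT.
  rewrite le_eqVlt eq_sym (negbTE s0)/= => s_gt0.
  by rewrite kern_gt0// subrr powRr0 mul1e mul1r mulN1r.
by move=> /negP; rewrite -ltNge => s_lt0; rewrite kern_le0 ?mul0e// ltW.
Qed.

(** The functional equation of Gamma: apply the Laplace transform to
    kern a * kern 1 = kern (a + 1) / a. *)
Lemma laplace1_kernS a : (0 < a)%R ->
  laplace1 (kern (a + 1)) = a%:E * laplace1 (kern a).
Proof.
move=> a0; have := laplace1_conv (nnm_kern a) (nnm_kern 1).
rewrite conv_kern1E// laplace1_kern1 mule1 => <-.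
rewrite laplace1Z ?lee_fin ?invr_ge0 ?ltW//; last exact: nnm_kern.
by rewrite muleA -EFinM mulfV ?gt_eqF// mul1e.
Qed.

(** On ]0, 1[ bound exp (- s) by 1, which leaves kern a * kern 1; on [1, +oo[
    bound s^(a - 1) by 1, which leaves the transform of kern 1. *)
Lemma laplace1_kern_le a : (0 < a <= 1)%R ->
  laplace1 (kern a) <= (a^-1 + 1)%:E.
Proof.
move=> /andP[a0 a1].
have -> : (a^-1 + 1)%:E = conv (kern a) (kern 1) 1%R + laplace1 (kern 1).
  by rewrite laplace1_kern1 conv_kern1// powR1 div1r.
rewrite -ge0_integralD//; last 4 first.
- by move=> s _; rewrite mule_ge0 ?(nnm_kern _).2.
- by apply: measurable_conv_integrand; exact: nnm_kern.
- by move=> s _; rewrite mule_ge0 ?(nnm_kern _).2// lee_fin expR_ge0.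
- exact: measurable_laplace (nnm_kern _).
apply: ge0_le_integral => //.
- by move=> s _; rewrite mule_ge0 ?(nnm_kern _).2// lee_fin expR_ge0.
- exact: measurable_laplace (nnm_kern _).
- apply: emeasurable_funD.
    by apply: measurable_conv_integrand; exact: nnm_kern.
  exact: measurable_laplace (nnm_kern _).
move=> s _; have [s0|s0] := leP s 0%R; first by rewrite !(kern_le0 _ s0) !mul0e adde0.
rewrite !(kern_gt0 _ s0) subrr powRr0 mul1e.
have [s1|s1] := ltP s 1%R.
  rewrite kern_gt0 ?subr_gt0// subrr powRr0 mule1 -EFinM -EFinD lee_fin.
  rewrite -[leLHS]addr0 lerD ?expR_ge0//.
  by rewrite ler_piMr ?powR_ge0// -expR0 ler_expR oppr_le0 ltW.
rewrite kern_le0 ?subr_le0// mule0 add0e -EFinM lee_fin ler_piMl ?expR_ge0//.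
by rewrite -[leRHS](powRr0 s) ler_powR// subr_le0.
Qed.

(** The previous bound covers ]0, 1]; the functional equation extends it. *)
Lemma laplace1_kern_fin a : (0 < a)%R -> laplace1 (kern a) \is a fin_num.
Proof.
move=> a0; have [n] : exists n : nat, (a <= n.+1%:R)%R.
  exists (Num.bound a); rewrite (le_trans (ltW (archi_boundP (ltW a0))))//.
  by rewrite ler_nat.
elim: n a a0 => [|n IH] a a0 an.
  rewrite ge0_fin_numE; last exact/laplace1_ge0/nnm_kern.
  by apply: le_lt_trans (ltry _); apply: laplace1_kern_le; rewrite a0.
have [a1|a1] := leP a 1%R.
  rewrite ge0_fin_numE; last exact/laplace1_ge0/nnm_kern.
  by apply: le_lt_trans (ltry _); apply: laplace1_kern_le; rewrite a0.
rewrite -(subrK 1%R a) laplace1_kernS ?subr_gt0// fin_numM// IH ?subr_gt0//.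
by rewrite lerBlDr natr1.
Qed.

Lemma laplace1_kern a : (0 < a)%R -> laplace1 (kern a) = (Gamma a)%:E.
Proof.
move=> a0; rewrite -[LHS]fineK; last exact: laplace1_kern_fin.
rewrite /Gamma /Rintegral; congr (fine _)%:E.
rewrite [RHS]integral_mkcond; apply: eq_integral => s _.
rewrite patchE; case: ifPn; rewrite ?inE ?notin_setE /= in_itv/= andbT.
  by move=> s0; rewrite kern_gt0.
by move=> /negP; rewrite -leNgt => s0; rewrite kern_le0 ?mul0e.
Qed.

Lemma Gamma1 : Gamma 1 = 1%R :> R.
Proof. by have := laplace1_kern1; rewrite laplace1_kern// => -[]. Qed.

Lemma GammaS a : (0 < a)%R -> (Gamma (a + 1) = a * Gamma a)%R.
Proof.
move=> a0; have := laplace1_kernS a0.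
by rewrite !laplace1_kern ?addr_gt0// => -[].
Qed.

(** The part of the integral over [1, +oo[, where s^(a - 1) >= 1, is at least
    exp (- 1). *)
Lemma Gamma_ge_expRN1 a : (1 <= a)%R -> (expR (- 1) <= Gamma a)%R.
Proof.
move=> a1; rewrite -lee_fin -laplace1_kern; last by lra.
have -> : (expR (- 1))%:E = \int[mu]_s (kern 1 (s - 1)%R * (expR (- s))%:E) :> \bar R.
  rewrite (@ge0_integral_affine R 1%R 1%R)//; last 2 first.
  - apply: emeasurable_funM.
      by apply: (measurableT_comp (nnm_kern _).1); apply: measurable_funB.
    by apply/measurable_EFinP; apply: measurableT_comp.
  - by move=> s; rewrite mule_ge0 ?(nnm_kern _).2// lee_fin expR_ge0.
  rewrite normr1 mul1e -[LHS]mule1 -laplace1_kern1 -ge0_integralZl ?lee_fin ?expR_ge0//.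
  - apply: eq_integral => s _; rewrite mul1r addrK opprD addrC expRD EFinM.
    by rewrite muleCA.
  - exact: measurable_laplace (nnm_kern _).
  - by move=> s _; rewrite mule_ge0 ?(nnm_kern _).2// lee_fin expR_ge0.
apply: ge0_le_integral => //.
- by move=> s _; rewrite mule_ge0 ?(nnm_kern _).2// lee_fin expR_ge0.
- apply: emeasurable_funM.
    by apply: (measurableT_comp (nnm_kern _).1); apply: measurable_funB.
  by apply/measurable_EFinP; apply: measurableT_comp.
- exact: measurable_laplace (nnm_kern _).
move=> s _; apply: lee_wpmul2r; first by rewrite lee_fin expR_ge0.
have [s1|s1] := leP s 1%R; first by rewrite kern_le0 ?subr_le0// (nnm_kern _).2.
rewrite kern_gt0 ?subr_gt0// kern_gt0 ?(lt_trans _ s1)// subrr powRr0 lee_fin.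
by rewrite -[leLHS](powRr0 s) ler_powR ?subr_ge0// ltW.
Qed.

Lemma Gamma_gt0 a : (0 < a)%R -> (0 < Gamma a :> R)%R.
Proof.
move=> a0; have : (0 < Gamma (a + 1) :> R)%R.
  by rewrite (lt_le_trans (expR_gt0 (- 1)))// Gamma_ge_expRN1// lerDr ltW.
by rewrite GammaS// pmulr_rgt0.
Qed.

(** Gamma (a + 1) = a Gamma a <= a (1 / a + 1). *)
Lemma GammaS_le2 a : (0 < a <= 1)%R -> (Gamma (a + 1) <= 2 :> R)%R.
Proof.
move=> a01; have /andP[a0 a1] := a01.
have := laplace1_kern_le a01; rewrite laplace1_kern// lee_fin GammaS// => H.
rewrite (@le_trans _ _ (a * (a^-1 + 1))%R)// ?ler_pM2l//.
by rewrite mulrDr mulfV ?gt_eqF// mulr1; lra.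
Qed.

(** Euler's Beta integral.  By scaling only a constant is unknown, and comparing
    Laplace transforms determines it. *)
Lemma conv_kern a b : (0 < a)%R -> (0 < b)%R ->
  conv (kern a) (kern b) =
  (fun t => (Gamma a * Gamma b / Gamma (a + b))%:E * kern (a + b) t).
Proof.
move=> a0 b0; apply/funext => t; rewrite conv_kern_scale; congr (_ * _).
have ab0 : (0 < a + b)%R by rewrite addr_gt0.
have Gab : (Gamma (a + b) != 0 :> R)%R by rewrite gt_eqF ?Gamma_gt0.
have := laplace1_conv (nnm_kern a) (nnm_kern b).
rewrite (_ : conv _ _ = (fun t => conv (kern a) (kern b) 1 * kern (a + b) t)); last first.
  by apply/funext => s; rewrite -conv_kern_scale.
have c0 := (nnm_conv (nnm_kern a) (nnm_kern b)).2 1%R.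
rewrite (laplace1Z c0 (nnm_kern _)).
rewrite !laplace1_kern// -EFinM => /(congr1 (fun z : \bar R => z * ((Gamma (a + b))^-1)%:E)).
by rewrite -muleA -!EFinM mulfV// mule1 => ->; rewrite kern_gt0// powR1 mule1.
Qed.

End Kernels.

(** * Smooth functions of one variable *)

Section Smooth.
Context {R : realType}.
Implicit Types f g : R -> R.

(** The recursion takes the derivative first, unlike derive1n: this is what the
    inductions on the product and chain rules need. *)
Fixpoint Cn (n : nat) f : Prop :=
  if n is m.+1 then (forall x : R, derivable f x 1) /\ Cn m (derive1 f) else True.

Definition smooth f := forall n, Cn n f.

Lemma smooth_derivable f n x : smooth f -> derivable (derive1n n f) x 1.
Proof.
move=> /(_ n.+1); elim: n f => [|n IH] f [df]; first by move=> _; exact: df.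
by move/IH; rewrite /derive1n iterSr.
Qed.

Lemma CnW n f : Cn n.+1 f -> Cn n f.
Proof. by elim: n f => // n IH f [df /IH]. Qed.

Lemma Cn_is_derive n (f f' : R -> R) : (forall x : R, is_derive x 1 f (f' x)) -> Cn n f' ->
  Cn n.+1 f.
Proof.
move=> df; have -> : f' = derive1 f.
  by apply/funext => x; rewrite derive1E (@derive_val _ _ _ _ _ _ _ (df x)).
by split => // x; apply: ex_derive.
Qed.

Lemma Cn_cst n (c : R) : Cn n (fun=> c).
Proof.
elim: n c => // n IH c.
by apply: (@Cn_is_derive _ _ (fun=> 0)) => // x; exact: is_derive_cst.
Qed.

Lemma Cn_id n : Cn n (fun x : R => x).
Proof.
case: n => // n; by apply: (@Cn_is_derive _ _ (fun=> 1)) (Cn_cst _ _).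
Qed.

Lemma Cn_is_deriveP n f : Cn n.+1 f -> forall x : R, is_derive x 1 f (derive1 f x).
Proof. by move=> [df _] x; rewrite derive1E; exact/derivableP. Qed.

Lemma CnD n f g : Cn n f -> Cn n g -> Cn n (fun x => f x + g x).
Proof.
elim: n f g => // n IH f g Cf Cg.
apply: (@Cn_is_derive _ _ (fun x => derive1 f x + derive1 g x)).
  by move=> x; exact: is_deriveD (Cn_is_deriveP Cf x) (Cn_is_deriveP Cg x).
by apply: IH; [exact: Cf.2|exact: Cg.2].
Qed.

Lemma CnM n f g : Cn n f -> Cn n g -> Cn n (fun x => f x * g x).
Proof.
elim: n f g => // n IH f g Cf Cg.
apply: (@Cn_is_derive _ _ (fun x => f x * derive1 g x + g x * derive1 f x)).
  by move=> x; exact: is_deriveM (Cn_is_deriveP Cf x) (Cn_is_deriveP Cg x).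
apply: CnD; apply: IH; solve [exact: CnW | exact: Cf.2 | exact: Cg.2].
Qed.

Lemma Cn_comp n f g : Cn n f -> Cn n g -> Cn n (f \o g).
Proof.
elim: n f g => // n IH f g Cf Cg.
apply: (@Cn_is_derive _ _ (fun x => derive1 f (g x) * derive1 g x)).
  move=> x; exact: is_derive1_comp (Cn_is_deriveP Cf _) (Cn_is_deriveP Cg x).
by apply: CnM; [apply: IH; [exact: Cf.2|exact: CnW]|exact: Cg.2].
Qed.

End Smooth.

(** * Smooth functions vanishing on a half-line *)

Section FlatFunctions.
Context {R : realType}.
Implicit Types (p : {poly R}) (x y : R).

(** One term of the exponential series. *)
Lemma exprn_le_expR (n : nat) y : 0 <= y -> y ^+ n <= n`!%:R * expR y.
Proof.
move=> y0; case: n => [|n]; first by rewrite expr0 fact0 mul1r -expR0 ler_expR.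
rewrite mulrC -ler_pdivrMr ?ltr0n ?fact_gt0//.
by apply: le_trans (expR_ge1Dxn n y0); rewrite lerDr.
Qed.

Lemma horner_le_expR p : exists2 C : R, 0 <= C &
  forall y, 0 <= y -> `|p.[y]| <= C * expR y.
Proof.
exists (\sum_(i < size p) `|p`_i| * i`!%:R).
  by apply: sumr_ge0 => i _; rewrite mulr_ge0.
move=> y y0; rewrite horner_coef (le_trans (ler_norm_sum _ _ _))// mulr_suml.
apply: ler_sum => i _; rewrite normrM -mulrA ler_wpM2l//.
by rewrite ger0_norm ?exprn_ge0// exprn_le_expR.
Qed.

(** Polynomials in 1/x times exp(-1/x), extended by 0 to the negative
    half-line: a family closed under derivation, whence its smoothness. *)
Definition flat p x : R := if 0 < x then p.[x^-1] * expR (- x^-1) else 0.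

Lemma flat_gt0E p x : 0 < x -> flat p x = p.[x^-1] * expR (- x^-1).
Proof. by move=> x0; rewrite /flat x0. Qed.

Lemma flat_le0E p x : x <= 0 -> flat p x = 0.
Proof. by move=> x0; rewrite /flat ltNge x0. Qed.

Lemma flat_bounded p : exists2 C : R, 0 <= C & forall x, `|flat p x| <= C.
Proof.
have [C C0 HC] := horner_le_expR p; exists C => // x.
have [x0|x0] := leP x 0; first by rewrite flat_le0E// normr0.
rewrite flat_gt0E// normrM expRN normfV (ger0_norm (expR_ge0 _)).
by rewrite ler_pdivrMr ?expR_gt0// HC// invr_ge0 ltW.
Qed.

Lemma flat_mulX p x : 0 < x -> flat ('X * p) x = x^-1 * flat p x.
Proof. by move=> x0; rewrite !flat_gt0E// hornerM hornerX; ring. Qed.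

(** The difference quotient at 0 is at most C |h|. *)
Lemma is_derive_quadratic0 (f : R -> R) (C : R) : f 0 = 0 ->
  (forall x, `|f x| <= C * x ^+ 2) -> is_derive (0 : R) 1 f 0.
Proof.
move=> f0 fC.
have C0 : 0 <= C by rewrite -[C]mulr1 -(expr1n R 2) (le_trans _ (fC 1)).
have H : h^-1 *: (f (h *: (1 : R) + 0) - f 0) @[h --> (0 : R)^'] --> (0 : R).
  apply/cvgr0Pnorm_le => e e0; near=> h.
  have h0 : h != 0 by near: h; exact: nbhs_dnbhs_neq.
  rewrite f0 subr0 addr0 /GRing.scale/= mulr1 normrM normfV mulrC.
  rewrite ler_pdivrMr ?normr_gt0// (le_trans (fC h))//.
  have -> : h ^+ 2 = `|h| * `|h| by rewrite -normrM -expr2 ger0_norm ?sqr_ge0.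
  rewrite mulrA ler_wpM2r//.
  rewrite (@le_trans _ _ ((C + 1) * `|h|))// ?ler_wpM2r ?lerDl//.
  rewrite mulrC -ler_pdivlMr; last by lra.
  by near: h; apply: dnbhs0_le; rewrite divr_gt0// ltr_wpDl.
by split; [apply/cvg_ex; exists 0|exact/cvg_lim].
Unshelve. all: by end_near. Qed.

(** At 0, the bound on flat ('X * ('X * p)) says that flat p is quadratic, hence
    has derivative 0 there. *)
Lemma is_derive_flat p x : is_derive x 1 (flat p) (flat ('X^2 * (p - p^`())) x).
Proof.
have [x0|x0|->] := ltgtP x 0.
- rewrite flat_le0E ?ltW//.
  apply: (@near_eq_is_derive _ _ _ (fun=> 0)).
  by near=> y; rewrite flat_le0E// ltW//; near: y; exact: lt_nbhsl.
- apply: (@near_eq_is_derive _ _ _ (fun y => p.[y^-1] * expR (- y^-1))).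
    by near=> y; rewrite flat_gt0E//; near: y; exact: lt_nbhsr.
  have dV : is_derive x 1 (fun y : R => y^-1) (- x ^- 2).
    have := @is_deriveV _ (fun y : R => y) x 1 1 (lt0r_neq0 x0) _.
    by rewrite /GRing.scale/= mulr1; apply; exact: is_derive_id.
  have dp := is_derive1_comp (is_derive_poly p x^-1) dV.
  have dN : is_derive x 1 (fun y : R => - y^-1) (- - x ^- 2) := is_deriveN dV.
  have de := @is_derive1_comp _ expR (fun y : R => - y^-1) x _ _ (is_derive_expR _) dN.
  have H : is_derive x 1 (fun y : R => p.[y^-1] * expR (- y^-1)) _ :=
    is_deriveM dp de.
  apply: (is_derive_eq H).
  rewrite flat_gt0E// !hornerE /GRing.scale/=.
  rewrite exprVn; ring.
- have [C C0 HC] := flat_bounded ('X * ('X * p)).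
  rewrite flat_le0E//; apply: (@is_derive_quadratic0 _ C).
    by rewrite flat_le0E.
  move=> y; have [y0|y0] := leP y 0.
    by rewrite flat_le0E// normr0 mulr_ge0// sqr_ge0.
  have := HC y; rewrite !flat_mulX// !normrM normfV (gtr0_norm y0).
  by rewrite mulrA -expr2 exprVn mulrC ler_pdivrMr ?exprn_gt0.
Unshelve. all: by end_near. Qed.

Lemma smooth_flat p : smooth (flat p).
Proof.
move=> n; elim: n p => // n IH p.
by apply: Cn_is_derive (IH _) => x; exact: is_derive_flat.
Qed.

End FlatFunctions.

(** * Ramps, mollifiers and the test functions *)

Section TestFunctions.
Context {R : realType}.
Implicit Types (n : nat) (s t x y : R).

(** A smooth approximation of the Heaviside function, increasing with n. *)
Definition ramp n y : R := flat 1 (n.+1%:R * y).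

(** The derivative of the ramp. *)
Definition mollifier n y : R := n.+1%:R * flat 'X^2 (n.+1%:R * y).

Lemma ramp_le0 n y : y <= 0 -> ramp n y = 0.
Proof. by move=> y0; rewrite /ramp flat_le0E// mulr_ge0_le0. Qed.

Lemma ramp_gt0 n y : 0 < y -> ramp n y = expR (- (n.+1%:R * y)^-1).
Proof. by move=> y0; rewrite /ramp flat_gt0E ?mulr_gt0// hornerE mul1r. Qed.

Lemma ramp_ge0 n y : 0 <= ramp n y.
Proof.
have [y0|y0] := leP y 0; first by rewrite ramp_le0.
by rewrite ramp_gt0// expR_ge0.
Qed.

Lemma ramp_le1 n y : ramp n y <= 1.
Proof.
have [y0|y0] := leP y 0; first by rewrite ramp_le0.
by rewrite ramp_gt0// -expR0 ler_expR oppr_le0 invr_ge0 mulr_ge0// ltW.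
Qed.

Lemma ramp_nd y : {homo ramp^~ y : n m / (n <= m)%N >-> n <= m}.
Proof.
move=> n m nm; have [y0|y0] := leP y 0; first by rewrite !ramp_le0.
rewrite !ramp_gt0// ler_expR lerN2 lef_pV2 ?posrE ?mulr_gt0//.
by rewrite ler_pM2r// ler_nat.
Qed.

Lemma ramp_cvg y : (ramp n y)%:E @[n --> \oo] --> kern 1 y.
Proof.
have [y0|y0] := leP y 0.
  by rewrite kern_le0//; under eq_fun do rewrite ramp_le0//; exact: cvg_cst.
rewrite kern_gt0// subrr powRr0; under eq_fun do rewrite ramp_gt0//.
apply: cvg_EFin; first by near=> n.
rewrite /comp/= [X in _ --> X](_ : 1 = expR (- 0)); last by rewrite oppr0 expR0.
apply: continuous_cvg; first exact: continuous_expR.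
apply: cvgN; rewrite [X in _ --> X](_ : 0 = y^-1 * 0); last by rewrite mulr0.
under eq_fun do rewrite invfM mulrC.
apply: cvgMr; exact: cvg_harmonic.
Unshelve. all: by end_near. Qed.

Lemma mollifier_le0 n y : y <= 0 -> mollifier n y = 0.
Proof. by move=> y0; rewrite /mollifier flat_le0E ?mulr0// mulr_ge0_le0. Qed.

Lemma mollifier_ge0 n y : 0 <= mollifier n y.
Proof.
have [y0|y0] := leP y 0; first by rewrite mollifier_le0.
rewrite /mollifier flat_gt0E ?mulr_gt0// hornerXn mulr_ge0// mulr_ge0 ?expR_ge0//.
by rewrite exprn_ge0// invr_ge0 mulr_ge0// ltW.
Qed.

Lemma mollifier_bounded n : exists2 C, 0 <= C & forall y, mollifier n y <= C.
Proof.
have [C C0 HC] := flat_bounded ('X^2 : {poly R}).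
exists (n.+1%:R * C) => [|y]; first by rewrite mulr_ge0.
by rewrite ler_wpM2l// (le_trans (ler_norm _)).
Qed.

Lemma is_derive_ramp n y : is_derive y 1 (ramp n) (mollifier n y).
Proof.
have dl : is_derive y 1 (fun x => n.+1%:R * x) n.+1%:R.
  have := @is_deriveZ _ _ _ id n.+1%:R y 1 1 (is_derive_id _ _).
  by rewrite /GRing.scale/= mulr1.
have H := @is_derive1_comp _ (flat 1) (fun x => n.+1%:R * x) y _ _
  (is_derive_flat 1 _) dl.
by apply: (is_derive_eq H); rewrite derivC subr0 mulr1 mulrC.
Qed.

Lemma continuous_ramp n : continuous (ramp n).
Proof.
move=> y; apply: differentiable_continuous; apply/derivable1_diffP.
by have [] := is_derive_ramp n y.
Qed.

Lemma continuous_mollifier n : continuous (mollifier n).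
Proof.
move=> y; apply: cvgMr.
have c : {for n.+1%:R * y, continuous (flat ('X^2 : {poly R}))}.
  apply: differentiable_continuous; apply/derivable1_diffP.
  by have [] := is_derive_flat ('X^2 : {poly R}) (n.+1%:R * y).
apply: (@continuous_comp _ _ _ (fun x => n.+1%:R * x) (flat 'X^2) y) => //.
by apply: cvgMr; exact: cvg_id.
Qed.

Lemma nnm_ramp n : nnm (EFin \o ramp n).
Proof.
split; last by move=> y; rewrite lee_fin ramp_ge0.
by apply/measurable_EFinP; apply: continuous_measurable_fun; exact: continuous_ramp.
Qed.

Lemma nnm_mollifier n : nnm (EFin \o mollifier n).
Proof.
split; last by move=> y; rewrite lee_fin mollifier_ge0.
apply/measurable_EFinP; apply: continuous_measurable_fun.
exact: continuous_mollifier.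
Qed.

Lemma conv_kern1_mollifier n :
  conv (kern 1) (EFin \o mollifier n) = EFin \o ramp n.
Proof.
rewrite convC; [|exact: nnm_kern|exact: nnm_mollifier].
apply/funext => t; have [t0|t0] := leP t 0.
  rewrite /= ramp_le0//; apply: integral0_eq => s _.
  have [s0|s0] := leP s 0; first by rewrite /= mollifier_le0 ?mul0e.
  by rewrite kern_le0 ?mule0//; lra.
transitivity (\int[lebesgue_measure]_(s in `]0%R, t]) (mollifier n s)%:E)%E.
  rewrite conv_kern1_causal; last by move=> s s0; rewrite /= mollifier_le0.
  rewrite -integral_itv_bndo_bndc//.
  by apply: measurable_funTS; exact: (nnm_mollifier n).1.
transitivity ((ramp n t - 0)%:E)%E; last by rewrite subr0.
apply: ge0_FTC2_oc => //.
- by move=> x _; exact: mollifier_ge0.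
- by move=> x _; exact: continuous_mollifier.
- by move=> x _; exact: is_derive_ramp.
- apply: cvg_at_right_filter; rewrite -[X in _ --> X](ramp_le0 n (lexx 0)).
  exact: continuous_ramp.
Qed.

(** On the positive half-line this is the ramp x |-> ramp n (t - x); the first
    factors only cut it off smoothly on the left. *)
Definition test_fun n t x : R :=
  (flat 1 2^-1)^-1 * flat 1 (2^-1 - flat 1 (- x)) * ramp n (t - x).

Lemma test_fun_ge0E n t x : 0 <= x -> test_fun n t x = ramp n (t - x).
Proof.
move=> x0; rewrite /test_fun (@flat_le0E _ _ (- x)) ?oppr_le0// subr0.
by rewrite mulVf ?mul1r// flat_gt0E// hornerE mul1r gt_eqF// expR_gt0.
Qed.

(** The support lies in [- 2, t]: left of - 2 the number exp (1 / x) exceeds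
    1 / 2, and the second factor vanishes. *)
Lemma test_function_test_fun n (t T : R) : t < T -> test_function T (test_fun n t).
Proof.
move=> tT; split.
  move=> k x; apply: smooth_derivable => {k x} k.
  have CB c : Cn k (fun x : R => c - x).
    rewrite (_ : (fun x : R => c - x) = (fun x => c + -1 * x)); last first.
      by apply/funext => x; rewrite mulN1r.
    by apply: CnD; [exact: Cn_cst|apply: CnM; [exact: Cn_cst|exact: Cn_id]].
  apply: CnM; last first.
    apply: (@Cn_comp _ _ (fun x => flat 1 (n.+1%:R * x)) (fun x => t - x)) => //.
    apply: (@Cn_comp _ _ (flat 1) (fun x => n.+1%:R * x)); first exact: smooth_flat.
    by apply: CnM; [exact: Cn_cst|exact: Cn_id].
  apply: CnM; first exact: Cn_cst.
  apply: (@Cn_comp _ _ (flat 1)); first exact: smooth_flat.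
  apply: (@Cn_comp _ _ (fun x => 2^-1 - x)) => //.
  apply: (@Cn_comp _ _ (flat 1)); first exact: smooth_flat.
  have := CB 0; congr (Cn k _); apply/funext => x; exact: sub0r.
exists (- 2), t; split => // x; apply: contraR.
rewrite negb_and -!ltNge => /orP[x2|tx]; last by rewrite /test_fun ramp_le0 ?mulr0// subr_le0 ltW.
rewrite /test_fun (@flat_le0E _ _ (2^-1 - _)) ?mulr0 ?mul0r// subr_le0.
rewrite flat_gt0E; last by lra.
rewrite hornerE mul1r; apply: (@le_trans _ _ (1 + - (- x)^-1)); last exact: expR_ge1Dx.
suff : (- x)^-1 <= 2^-1 by lra.
by rewrite lef_pV2 ?posrE//; lra.
Qed.

Lemma derive1_test_fun n t s x : 0 <= s -> 0 < x ->
  derive1 (fun y => test_fun n t (y + s)) x = - mollifier n (t - s - x).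
Proof.
move=> s0 x0.
have dB : is_derive x 1 (fun y => t - s - y) (- 1 : R).
  have := @is_deriveB _ _ _ (cst (t - s)) id x 1 0 1 (is_derive_cst _ _ _) (is_derive_id _ _).
  by rewrite sub0r.
have H := @is_derive1_comp _ (ramp n) (fun y => t - s - y) x _ _
  (is_derive_ramp n _) dB.
rewrite derive1E (@near_eq_derive _ _ _ _ (ramp n \o (fun y => t - s - y))).
  by rewrite (@derive_val _ _ _ _ _ _ _ H) mulrN1.
near=> y; rewrite test_fun_ge0E/=; first by congr (ramp n _); ring.
by rewrite addr_ge0// ltW//; near: y; exact: lt_nbhsr.
Unshelve. all: by end_near. Qed.

End TestFunctions.

(** * Functions supported in a bounded interval *)

Section Causal.
Context {R : realType}.
Local Notation mu := (@lebesgue_measure R).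
Local Open Scope ereal_scope.
Implicit Types (f g : R -> R) (F G H : R -> \bar R) (T t : R).

(** Cutting off at T makes convolutions with causal kernels meaningful on the
    whole line without changing them before T. *)
Definition trunc T f : R -> \bar R := (EFin \o f) \_ `]0%R, T[.

Lemma truncE T f t : (0 < t < T)%R -> trunc T f t = (f t)%:E.
Proof. by move=> tT; rewrite /trunc patchE mem_set//= in_itv. Qed.

Lemma trunc0 T f t : ~~ (0 < t < T)%R -> trunc T f t = 0.
Proof. by move=> tT; rewrite /trunc patchE memNset//= in_itv/=; exact/negP. Qed.

Lemma nnm_trunc T f : measurable_fun `]0%R, T[ f ->
  (forall t, (0 < t < T)%R -> (0 <= f t)%R) -> nnm (trunc T f).
Proof.
move=> mf f0; split.
  apply/(measurable_restrictT (EFin \o f)) => //; exact/measurable_EFinP.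
move=> t; have [tT|tT] := boolP (0 < t < T)%R; last by rewrite trunc0.
by rewrite truncE// lee_fin f0.
Qed.

Lemma trunc_fin_num T f t : trunc T f t \is a fin_num.
Proof.
have [tT|tT] := boolP (0 < t < T)%R; first by rewrite truncE.
by rewrite trunc0.
Qed.

Lemma conv_trunc T f G t :
  conv (trunc T f) G t = \int[mu]_(s in `]0%R, T[) ((f s)%:E * G (t - s)%R).
Proof.
rewrite [RHS]integral_mkcond; apply: eq_integral => s _; rewrite patchE.
have [sT|sT] := boolP (0 < s < T)%R.
  by rewrite truncE// mem_set//= in_itv.
by rewrite trunc0// mul0e memNset//= in_itv/=; exact/negP.
Qed.

Lemma le_conv F G H t : nnm F -> nnm G -> nnm H -> (forall x, F x <= G x) ->
  conv F H t <= conv G H t.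
Proof.
move=> mF mG mH FG; apply: ge0_le_integral => //.
- by move=> s _; rewrite mule_ge0 ?mF.2 ?mH.2.
- exact: measurable_conv_integrand.
- exact: measurable_conv_integrand.
- by move=> s _; rewrite lee_wpmul2r ?mH.2.
Qed.

(** A causal kernel only sees the past. *)
Lemma eq_conv_causal F G H t : (forall x, (x <= 0)%R -> H x = 0) ->
  (forall s, (s < t)%R -> F s = G s) -> conv F H t = conv G H t.
Proof.
move=> H0 FG; apply: eq_integral => s _.
have [st|ts] := ltP s t; first by rewrite FG.
by rewrite H0 ?mule0// subr_le0.
Qed.

Lemma trunc_le T f (M : R) x : (0 <= M)%R ->
  (forall t, (0 < t < T)%R -> (f t <= M)%R) -> trunc T f x <= M%:E * kern 1 x.
Proof.
move=> M0 fM; have [xT|xT] := boolP (0 < x < T)%R.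
  have /andP[x0 _] := xT.
  by rewrite truncE// kern_gt0// subrr powRr0 mule1 lee_fin fM.
by rewrite trunc0// mule_ge0 ?(nnm_kern _).2.
Qed.

Lemma conv_trunc_kern_le (a : R) T f (M : R) t : (0 < a)%R -> (0 <= M)%R ->
  measurable_fun `]0%R, T[ f -> (forall t, (0 < t < T)%R -> (0 <= f t <= M)%R) ->
  conv (trunc T f) (kern a) t <= M%:E * ((a^-1)%:E * kern (a + 1) t).
Proof.
move=> a0 M0 mf fM; apply: (@le_trans _ _ (conv (fun x => M%:E * kern 1 x) (kern a) t)).
  apply: le_conv; [|apply: nnmZ => //; exact: nnm_kern|exact: nnm_kern|].
    by apply: nnm_trunc => // s /fM/andP[].
  by move=> x; apply: trunc_le => // s /fM/andP[].
rewrite convZl//; [|exact: nnm_kern|exact: nnm_kern].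
by rewrite (convC (nnm_kern _) (nnm_kern _)) conv_kern1E.
Qed.

Lemma conv_trunc_kern_fin_num (a : R) T f (M : R) t : (0 < a)%R -> (0 <= M)%R ->
  measurable_fun `]0%R, T[ f -> (forall t, (0 < t < T)%R -> (0 <= f t <= M)%R) ->
  conv (trunc T f) (kern a) t \is a fin_num.
Proof.
move=> a0 M0 mf fM; rewrite ge0_fin_numE; last first.
  by apply: (nnm_conv _ (nnm_kern _)).2; apply: nnm_trunc => // s /fM/andP[].
by apply: le_lt_trans (conv_trunc_kern_le _ a0 M0 mf fM) _; rewrite -!EFinM ltry.
Qed.

Lemma bounded_integrable_oo T f (M : R) : measurable_fun `]0%R, T[ f ->
  (forall t, (0 < t < T)%R -> (`|f t| <= M)%R) ->
  mu.-integrable `]0%R, T[ (EFin \o f).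
Proof.
move=> mf fM; apply: measurable_bounded_integrable => //.
- rewrite [X in X < _]lebesgue_measure_itv/= lte_fin; by case: ifP => _; rewrite ?ltry.
- exists M; split; first exact: num_real.
  by move=> x Mx t /=; rewrite in_itv/= => /fM /le_trans; apply; exact: ltW.
Qed.

End Causal.

(** * The equation tested against ramps *)

Section FractionalMollifier.
Context {R : realType}.
Variables (gamma : R) (gamma01 : 0 < gamma < 1).

(** The mollified kernel t^(- gamma), against which the Caputo derivative of u
    integrates u - u0 when it is tested on a ramp. *)
Definition frac_mollifier n : R -> \bar R :=
  conv (kern (1 - gamma)) (EFin \o @mollifier R n).

Let g1 : 0 < 1 - gamma. Proof. by move: gamma01; lra. Qed.

Lemma nnm_frac_mollifier n : nnm (frac_mollifier n).
Proof. by apply: nnm_conv; [exact: nnm_kern|exact: nnm_mollifier]. Qed.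

Lemma frac_mollifier_le0 n r : r <= 0 -> frac_mollifier n r = 0%E.
Proof.
move=> r0; apply: integral0_eq => s _.
have [s0|s0] := leP s 0; first by rewrite kern_le0 ?mul0e.
by rewrite /= mollifier_le0 ?mule0//; lra.
Qed.

(** Bounding the mollifier by a constant C leaves C times the integral of the
    kernel. *)
Lemma frac_mollifier_bounded n t :
  exists2 Q : R, 0 <= Q & forall r, r <= t -> (frac_mollifier n r <= Q%:E)%E.
Proof.
have [C C0 HC] := @mollifier_bounded R n.
have t0 : 0 < `|t| + 1 by rewrite ltr_wpDl.
exists (C * ((`|t| + 1) `^ (1 - gamma) / (1 - gamma))).
  by rewrite mulr_ge0// divr_ge0 ?powR_ge0// ltW.
move=> r rt; have [r0|r0] := leP r 0.
  by rewrite frac_mollifier_le0// lee_fin mulr_ge0// divr_ge0 ?powR_ge0// ltW.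
rewrite /frac_mollifier convC; [|exact: nnm_kern|exact: nnm_mollifier].
apply: (@le_trans _ _ (conv (fun x => C%:E * kern 1 x)%E (kern (1 - gamma)) r)).
  apply: le_conv; [exact: nnm_mollifier|apply: nnmZ => //; exact: nnm_kern|exact: nnm_kern|].
  move=> x; have [x0|x0] := leP x 0; first by rewrite /= mollifier_le0// kern_le0// mule0.
  by rewrite kern_gt0// subrr powRr0 mule1 lee_fin.
rewrite convZl//; [|exact: nnm_kern|exact: nnm_kern].
rewrite convC; [|exact: nnm_kern|exact: nnm_kern].
rewrite conv_kern1// -EFinM lee_fin ler_wpM2l// ler_pM2r ?invr_gt0//.
rewrite ge0_ler_powR ?nnegrE ?ltW//.
by rewrite (le_lt_trans rt)// ltr_pwDr// ler_norm.
Qed.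

Lemma frac_mollifier_fin_num n r : frac_mollifier n r \is a fin_num.
Proof.
have [Q _ /(_ r (lexx r)) qQ] := frac_mollifier_bounded n r.
by rewrite ge0_fin_numE ?(nnm_frac_mollifier n).2// (le_lt_trans qQ)// ltry.
Qed.

End FractionalMollifier.

Section WeakEquation.
Context {R : realType}.
Local Notation mu := (@lebesgue_measure R).
Variables (gamma : R) (gamma01 : 0 < gamma < 1).

Let g1 : 0 < 1 - gamma. Proof. by move: gamma01; lra. Qed.

(** For s >= 0 only the values of the test function on the positive half-line
    matter, where its derivative is minus the mollifier. *)
Let g_neg_test_fun n t s : 0 <= s ->
  g_neg gamma (fun x => test_fun n t (x + s)) =
  (Gamma (1 - gamma))^-1 * fine (frac_mollifier gamma n (t - s)).
Proof.
move=> s0; rewrite /g_neg; congr (_ * _).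
rewrite /distr_derive /regular_distr /Rintegral -fineN; congr fine.
apply/eqP; rewrite eqe_oppLR; apply/eqP.
rewrite /frac_mollifier /conv -integral_ge0N; last first.
  by move=> x _; rewrite mule_ge0 ?(nnm_kern _).2 ?(nnm_mollifier _).2.
apply: eq_integral => x _; rewrite /heaviside.
have [x0|x0] := ltP 0 x.
  rewrite derive1_test_fun// ltW// mul1r kern_gt0//.
  rewrite -EFinM mulrN; congr (- (_ `^ _ * _))%:E; first by ring.
rewrite kern_le0// mul0e oppe0.
move: x0; rewrite le_eqVlt => /predU1P[->|x0].
  by rewrite powR0 ?mulr0 ?mul0r// oppr_eq0; move: gamma01; lra.
by rewrite leNgt x0 !mul0r.
Qed.

(** With u and u0 on different sides, both convolutions are of nonnegative
    functions. *)
Lemma caputo_test_fun n (t T u0 M : R) (u : R -> R) : 0 < t < T ->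
  measurable_fun `]0, T[ u -> (forall s, 0 < s < T -> 0 <= u s <= M) -> 0 <= u0 ->
  (conv (trunc T u) (frac_mollifier gamma n) t = conv (trunc T (cst u0)) (frac_mollifier gamma n) t +
    (Gamma (1 - gamma) * caputo gamma T u0 u (test_fun n t))%:E)%E.
Proof.
move=> /andP[t0 tT] mu_u uM u00.
have [Q Q0 HQ] := frac_mollifier_bounded gamma01 n t.
have qQ s : 0 < s < T -> 0 <= fine (frac_mollifier gamma n (t - s)) <= Q.
  move=> /andP[s0 sT]; rewrite -!lee_fin fineK ?frac_mollifier_fin_num// (nnm_frac_mollifier gamma n).2 HQ//.
  by rewrite lerBlDr lerDl ltW.
have mq : measurable_fun `]0, T[ (fun s => fine (frac_mollifier gamma n (t - s))).
  apply: measurable_funTS; apply: measurableT_comp => //.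
  exact: nnm_shift (nnm_frac_mollifier gamma n).
have iu : mu.-integrable `]0, T[ (EFin \o (fun s => u s * fine (frac_mollifier gamma n (t - s)))).
  apply: (@bounded_integrable_oo _ _ _ (M * Q)); first exact: measurable_funM.
  move=> s sT; have /andP[? ?] := qQ _ sT; have /andP[? ?] := uM _ sT.
  by rewrite ger0_norm ?mulr_ge0// ler_pM.
have iu0 : mu.-integrable `]0, T[ (EFin \o (fun s => u0 * fine (frac_mollifier gamma n (t - s)))).
  apply: (@bounded_integrable_oo _ _ _ (u0 * Q)); first exact: measurable_funM.
  move=> s sT; have /andP[? ?] := qQ _ sT.
  by rewrite ger0_norm ?mulr_ge0// ler_pM.
have convE f : mu.-integrable `]0, T[ (EFin \o (fun s => f s * fine (frac_mollifier gamma n (t - s)))) ->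
    conv (trunc T f) (frac_mollifier gamma n) t = (\int[mu]_(s in `]0, T[) (f s * fine (frac_mollifier gamma n (t - s))))%:E.
  move=> fi; rewrite /Rintegral fineK; last exact: integrable_fin_num.
  by rewrite conv_trunc; apply: eq_integral => s _; rewrite EFinM fineK// frac_mollifier_fin_num.
rewrite (convE _ iu) (convE _ iu0) -EFinD; congr EFin.
rewrite addrC; apply/eqP; rewrite -subr_eq -RintegralB//; apply/eqP.
have -> : caputo gamma T u0 u (test_fun n t) = (Gamma (1 - gamma))^-1 *
    \int[mu]_(s in `]0, T[) (u s * fine (frac_mollifier gamma n (t - s)) - u0 * fine (frac_mollifier gamma n (t - s))).
  rewrite -RintegralZl//; last first.
    exact: (integrableB _ iu iu0).
  rewrite /caputo /conv_distr /Rintegral; congr fine.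
  transitivity (\int[mu]_(s in `[0%R, T[) ((Gamma (1 - gamma))^-1 *
      (u s * fine (frac_mollifier gamma n (t - s)) - u0 * fine (frac_mollifier gamma n (t - s))))%:E)%E.
    rewrite [LHS]integral_mkcond [RHS]integral_mkcond; apply: eq_integral => s _.
    rewrite !patchE; have [s0|s0] := leP 0 s.
      case: ifPn; rewrite ?inE ?notin_setE /= in_itv/= => sT.
        rewrite mem_set/= ?in_itv/= ?s0//.
        rewrite g_neg_test_fun// /heaviside s0 mulr1; congr (_%:E); ring.
      by rewrite memNset//= in_itv/= s0.
    rewrite [in RHS]memNset/= ?in_itv/=; last by rewrite leNgt s0.
    by case: ifP => _; rewrite // /heaviside leNgt s0/= mulr0 mul0r.
  rewrite -integral_itv_obnd_cbnd//; apply/measurable_EFinP.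
  apply: measurable_funM => //; apply: measurable_funB; exact: measurable_funM.
by rewrite mulrA mulfV ?mul1r// gt_eqF// Gamma_gt0.
Qed.

End WeakEquation.

(** * The integrated Volterra equation *)

Section IntegratedVolterra.
Context {R : realType}.
Local Notation mu := (@lebesgue_measure R).
Variables (gamma T u0 M : R) (f u : R -> R).
Hypotheses (gamma01 : 0 < gamma < 1) (u0_ge0 : 0 <= u0).
Hypotheses (mu_u : measurable_fun `]0, T[ u)
  (mfu : measurable_fun `]0, T[ (f \o u)).
Hypothesis uM : forall s, 0 < s < T -> 0 <= u s <= M.
Hypothesis fuM : forall s, 0 < s < T -> 0 <= f (u s) <= M.
Hypothesis sol : strong_solution gamma f u0 T u.

Let g0 : 0 < gamma. Proof. by have /andP[] := gamma01. Qed.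
Let g1 : 0 < 1 - gamma. Proof. by move: gamma01; lra. Qed.

Let U := trunc T u.
Let U0 := trunc T (cst u0).
Let F := trunc T (f \o u).

Let nnmU : nnm U. Proof. by apply: nnm_trunc => // s /uM/andP[]. Qed.
Let nnmU0 : nnm U0. Proof. by apply: nnm_trunc. Qed.
Let nnmF : nnm F. Proof. by apply: nnm_trunc => // s /fuM/andP[]. Qed.

(** The right-hand side of the equation, tested against the same ramp. *)
Let source_ramp n t : 0 < t < T ->
  (conv F (EFin \o ramp n) t = (caputo gamma T u0 u (test_fun n t))%:E)%E.
Proof.
move=> /andP[t0 tT]; have [_ _ [h [hi hcap hae]]] := sol.
rewrite hcap; last exact: test_function_test_fun.
have mr : measurable_fun `]0, T[ (fun s => ramp n (t - s)).
  apply: measurable_funTS.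
  by apply: (measurableT_comp (continuous_measurable_fun (@continuous_ramp R n))); apply: measurable_funB.
have mh : measurable_fun `]0, T[ h by apply/measurable_EFinP; exact: (measurable_int mu).
rewrite /regular_distr /Rintegral.
have <- : (\int[mu]_(s in `]0%R, T[) ((f \o u) s * ramp n (t - s)%R)%:E =
    \int[mu]_(s in `]0%R, T[) (h s * test_fun n t s)%:E)%E.
  transitivity (\int[mu]_(s in `]0%R, T[) (h s * ramp n (t - s)%R)%:E)%E.
    apply: ae_eq_integral => //.
    - by apply/measurable_EFinP; exact: measurable_funM.
    - by apply/measurable_EFinP; exact: measurable_funM.
    - apply: (@filterS _ _ (ae_filter_ringOfSetsType mu) _ _ _ hae) => s hs sT.
      by rewrite /= -hs// mem_set.
  apply: eq_integral => s; rewrite inE/= in_itv/= => /andP[s0 _].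
  by rewrite test_fun_ge0E// ltW.
rewrite fineK.
  by rewrite conv_trunc; apply: eq_integral => s _; rewrite EFinM.
apply: integrable_fin_num => //; apply: (@bounded_integrable_oo _ _ _ M).
  exact: measurable_funM.
move=> s /fuM/andP[fu0 fuMs]; rewrite normrM !ger0_norm ?ramp_ge0//.
by rewrite -[leRHS]mulr1 ler_pM ?ramp_ge0// ramp_le1.
Qed.

Let weak_ramp n t : t < T ->
  (conv U (frac_mollifier gamma n) t = conv U0 (frac_mollifier gamma n) t +
    (Gamma (1 - gamma))%:E * conv F (EFin \o ramp n) t)%E.
Proof.
move=> tT; have [t0|t0] := leP t 0; last first.
  rewrite source_ramp ?t0// -EFinM.
  by apply: (caputo_test_fun gamma01 n _ mu_u uM) => //; rewrite t0.
have conv0 G H : (forall x, x <= 0 -> H x = 0%E) -> conv (trunc T G) H t = 0%E.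
  move=> H0; apply: integral0_eq => s _.
  have [s0|s0] := leP s 0; first by rewrite trunc0 ?mul0e// ltNge s0.
  by rewrite H0 ?mule0//; lra.
rewrite !conv0 ?mule0 ?adde0//.
- by move=> x x0; rewrite /= ramp_le0.
- by move=> x; exact: frac_mollifier_le0.
- by move=> x; exact: frac_mollifier_le0.
Qed.

(** The Beta integral with exponents gamma and 1 - gamma: integrating to order
    gamma undoes the derivative of order gamma. *)
Let conv_q_kern V n t : nnm V -> conv (conv V (frac_mollifier gamma n)) (kern gamma) t =
  ((Gamma gamma * Gamma (1 - gamma))%:E * conv V (EFin \o ramp n) t)%E.
Proof.
move=> nV; have B0 : 0 <= Gamma gamma * Gamma (1 - gamma).
  by rewrite mulr_ge0// ltW// Gamma_gt0.
rewrite (convA nV (nnm_frac_mollifier _ _) (nnm_kern _)).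
rewrite [conv (frac_mollifier _ _) _](convC (nnm_frac_mollifier _ _) (nnm_kern _)).
rewrite /frac_mollifier.
rewrite -(convA (nnm_kern gamma) (nnm_kern (1 - gamma)) (@nnm_mollifier R n)).
rewrite conv_kern// (_ : gamma + (1 - gamma) = 1); last by ring.
rewrite Gamma1 divr1 (convZl B0 (nnm_kern _) (nnm_mollifier _)).
rewrite conv_kern1_mollifier (convC nV (nnmZ B0 (nnm_ramp _))).
by rewrite (convZl B0 (nnm_ramp _) nV) (convC (nnm_ramp _) nV).
Qed.

(** Convolve the tested equation with kern gamma. *)
Let weak_volterra_ramp n t : t < T ->
  ((Gamma gamma)%:E * conv U (EFin \o ramp n) t =
   (Gamma gamma)%:E * conv U0 (EFin \o ramp n) t +
   conv (conv F (kern gamma)) (EFin \o ramp n) t)%E.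
Proof.
move=> tT; have Gg0 := Gamma_gt0 g0; have Gg1 := Gamma_gt0 g1.
have : conv (conv U (frac_mollifier gamma n)) (kern gamma) t =
  conv (conv U0 (frac_mollifier gamma n) \+ (fun t => (Gamma (1 - gamma))%:E * conv F (EFin \o ramp n) t))%E
    (kern gamma) t.
  apply: eq_conv_causal => [x|s st]; first exact: kern_le0.
  by rewrite /= -weak_ramp// (lt_trans st).
have nUq := nnm_conv nnmU0 (nnm_frac_mollifier gamma n).
have nFr := nnm_conv nnmF (@nnm_ramp R n).
rewrite (convDl nUq (nnmZ (ltW Gg1) nFr) (nnm_kern _)) (convZl (ltW Gg1) nFr (nnm_kern _)).
rewrite /= (conv_q_kern n t nnmU) (conv_q_kern n t nnmU0).
rewrite (convA nnmF (nnm_ramp _) (nnm_kern _)) (convC (nnm_ramp _) (nnm_kern _)).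
rewrite -(convA nnmF (nnm_kern _) (nnm_ramp _)).
have ge0 V : nnm V -> (0 <= conv V (EFin \o @ramp R n) t)%E.
  by move=> nV; exact: (nnm_conv nV (nnm_ramp _)).2.
have := ge0 _ (nnm_conv nnmF (nnm_kern gamma)); have := ge0 _ nnmU0.
move: (conv U _ t) (conv U0 _ t) (conv (conv F _) _ t) => a b c b0 c0.
move=> /(congr1 (fun z : \bar R => ((Gamma (1 - gamma))^-1)%:E * z)%E).
rewrite ge0_muleDr; last 2 first.
- by rewrite mule_ge0// lee_fin mulr_ge0 ?ltW.
- by rewrite mule_ge0// lee_fin ltW.
rewrite !muleA -!EFinM mulVf ?gt_eqF// mul1e.
by rewrite mulrCA mulVf ?gt_eqF// mulr1.
Qed.

(** The ramps increase to kern 1, the Heaviside function. *)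
Lemma integrated_volterra t : t < T ->
  ((Gamma gamma)%:E * conv U (kern 1) t =
   (Gamma gamma)%:E * conv U0 (kern 1) t + conv (conv F (kern gamma)) (kern 1) t)%E.
Proof.
move=> tT; have Gg0 := Gamma_gt0 g0.
have cv V : nnm V -> (forall x, V x \is a fin_num) ->
    conv V (EFin \o @ramp R n) t @[n --> \oo] --> conv V (kern 1) t.
  move=> nV Vfin; apply: cvg_conv => //.
  - by move=> n; exact: nnm_ramp.
  - by move=> x n m nm; rewrite lee_fin ramp_nd.
  - exact: ramp_cvg.
have nFk : nnm (conv F (kern gamma)) by apply: nnm_conv => //; exact: nnm_kern.
have Fk_fin s : conv F (kern gamma) s \is a fin_num.
  apply: (conv_trunc_kern_fin_num _ g0 (normr_ge0 M) mfu) => r /fuM/andP[-> fM].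
  by rewrite (le_trans fM)// ler_norm.
have conv1_ge0 V : nnm V -> (0 <= conv V (kern 1) t)%E.
  by move=> nV; exact: (nnm_conv nV (nnm_kern _)).2.
have L1 := cvgeZl (y := (Gamma gamma)%:E) isT (cv _ nnmU (trunc_fin_num _ _)).
have L2 := cvgeZl (y := (Gamma gamma)%:E) isT (cv _ nnmU0 (trunc_fin_num _ _)).
have L3 := cvgeD (ge0_adde_def _ _) L2 (cv _ nFk Fk_fin).
rewrite -(cvg_lim _ L1)// -(cvg_lim _ (L3 _ _ _))//.
- by congr (limn _); apply/funext => n; exact: weak_volterra_ramp.
- by rewrite inE mule_ge0 ?conv1_ge0// lee_fin ltW.
- by rewrite inE conv1_ge0.
Qed.

End IntegratedVolterra.

(** * From the integrated to the pointwise Volterra equation *)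

Section PointwiseVolterra.
Context {R : realType}.
Local Notation mu := (@lebesgue_measure R).
Implicit Types (T t s gamma M : R) (f g : R -> R).

(** Differentiate both primitives at t. *)
Lemma eq_of_primitives f g T :
  mu.-integrable `]0, T[ (EFin \o f) -> mu.-integrable `]0, T[ (EFin \o g) ->
  (forall t, 0 < t < T -> {for t, continuous f}) ->
  (forall t, 0 < t < T -> {for t, continuous g}) ->
  (forall t, 0 < t < T ->
     \int[mu]_(s in `]0, t[) f s = \int[mu]_(s in `]0, t[) g s) ->
  forall t, 0 < t < T -> f t = g t.
Proof.
move=> fi gi cf cg fg t tT; have /andP[t0 t_T] := tT.
have [x /andP[tx xT]] : exists x, t < x < T.
  by exists ((t + T) / 2); rewrite !(midf_lt t_T).
have sub y : y < T -> `]0, y] `<=` `]0, T[.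
  by move=> yT s /=; rewrite !in_itv/= => /andP[-> /le_lt_trans]; exact.
have ix h : mu.-integrable `]0, T[ (EFin \o h) -> mu.-integrable `]0, x] (EFin \o h).
  by move=> hi; apply: integrableS hi => //; exact: sub.
have a0t : ((BRight 0 : itv_bound R) < BRight t)%O by rewrite bnd_simp.
have [_ <-] := continuous_FTC1 tx (ix _ fi) a0t (cf _ tT).
have [_ <-] := continuous_FTC1 tx (ix _ gi) a0t (cg _ tT).
rewrite !derive1E; apply: near_eq_derive; near=> y.
have yT : 0 < y < T.
  by apply/andP; split; near: y; [exact: lt_nbhsr|exact: lt_nbhsl].
have iy h : mu.-integrable `]0, T[ (EFin \o h) -> mu.-integrable `]0, y[ (EFin \o h).
  move=> hi; apply: integrableS hi => // s /=; rewrite !in_itv/= => /andP[-> /lt_trans].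
  by apply; case/andP : yT.
by rewrite -!Rintegral_itv_bndo_bndc ?fg//; exact: iy.
Unshelve. all: by end_near. Qed.

(** Dominated convergence along a sequence v --> t0, on the form
    kern gamma s * F (v n - s), F being f cut off: the integrand converges except
    perhaps at s = t0, since F may jump at 0. *)
Lemma continuous_conv_kern gamma T M f : 0 < gamma ->
  measurable_fun `]0, T[ f -> (forall t, 0 < t < T -> 0 <= f t <= M) ->
  (forall t, 0 < t < T -> {for t, continuous f}) ->
  forall t, 0 < t < T ->
  {for t, continuous (fun t => fine (conv (trunc T f) (kern gamma) t))}.
Proof.
move=> g0 mf fM cf t0 t0T; have /andP[t0_gt0 t0_lt] := t0T.
have T0 : 0 < T by exact: lt_trans t0_lt.
have M0 : 0 <= M by have /andP[] := fM _ t0T; exact: le_trans.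
pose F := trunc T f.
have nF : nnm F by apply: nnm_trunc => // s /fM/andP[].
have F_le s : (F s <= M%:E * kern 1 s)%E by apply: trunc_le => // r /fM/andP[].
apply/(@cvg_nbhsP _ R^o) => v vt.
(* Cutting v at T makes the dominating function integrable for every n. *)
pose w n := Num.min (v n) T.
have vw : \forall n \near \oo, v n = w n.
  near=> n; rewrite /w min_l//; near: n; exact: (cvgr_le t0 vt).
have wt : w n @[n --> \oo] --> t0 by apply: cvg_trans vt; exact: near_eq_cvg.
apply: cvg_trans (_ : fine (conv F (kern gamma) (w n)) @[n --> \oo] --> _).
  by apply: near_eq_cvg; near=> n; rewrite -/F; congr (fine (conv _ _ _)); apply/esym; near: n.
rewrite convC//; last exact: nnm_kern.
pose G n s := (kern gamma s * F (w n - s)%R)%E.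
pose dom s := (M%:E * (kern gamma s * kern 1 (T - s)%R))%E.
have mG n : measurable_fun setT (G n).
  by apply: measurable_conv_integrand => //; exact: nnm_kern.
have idom : mu.-integrable setT dom.
  apply/integrableP; split.
    apply: emeasurable_funM => //.
    by apply: measurable_conv_integrand; exact: nnm_kern.
  under eq_integral do rewrite gee0_abs ?mule_ge0 ?(nnm_kern _).2//.
  rewrite ge0_integralZl//; last 2 first.
  - by apply: measurable_conv_integrand; exact: nnm_kern.
  - by move=> s _; rewrite mule_ge0 ?(nnm_kern _).2.
  by rewrite -/(conv _ _ T) conv_kern1// -EFinM ltry.
have Gdom n s : (`|G n s| <= dom s)%E.
  rewrite gee0_abs; last by rewrite mule_ge0 ?(nnm_kern _).2 ?nF.2.
  rewrite /dom muleCA; apply: lee_wpmul2l; first exact: (nnm_kern _).2.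
  apply: (le_trans (F_le _)); apply: lee_wpmul2l => //.
  have [ws|ws] := leP (w n - s) 0; first by rewrite kern_le0 ?(nnm_kern _).2.
  rewrite !kern_gt0 ?subrr ?powRr0//.
  by rewrite (lt_le_trans ws)// lerB// /w ge_min lexx orbT.
have cvgG : \forall s \ae mu, setT s ->
    G n s @[n --> \oo] --> (kern gamma s * F (t0 - s)%R)%E.
  exists [set t0]; split => //; first exact: lebesgue_measure_set1.
  move=> s /=; apply: contra_notP => st0 _.
  have [s0|s_gt0] := leP s 0.
    under eq_fun do rewrite /G kern_le0// mul0e.
    by rewrite kern_le0// mul0e; exact: cvg_cst.
  apply: cvgeZl => //.
  have ws : w n - s @[n --> \oo] --> t0 - s by apply: cvgB => //; exact: cvg_cst.
  have [ts|ts] := ltP (t0 - s) 0.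
    rewrite {2}/F trunc0 ?(ltNge 0) ?(ltW ts)//.
    apply: cvg_near_cst; near=> n; rewrite /F trunc0// negb_and -leNgt; apply/orP; left.
    by near: n; exact: (cvgr_le _ ws).
  have tsT : 0 < t0 - s < T.
    rewrite lt_neqAle ts andbT eq_sym subr_eq0 eq_sym; apply/andP; split; first exact/eqP.
    by rewrite ltrBlDr (lt_trans t0_lt)// ltrDl.
  rewrite {2}/F truncE//; apply: (@cvg_trans _ ((f (w n - s))%:E @[n --> \oo])).
    apply: near_eq_cvg; near=> n; rewrite /F truncE//; apply/andP; split.
      by near: n; apply: (cvgr_gt _ ws); case/andP : tsT.
    by near: n; apply: (cvgr_lt _ ws); case/andP : tsT.
  apply: cvg_EFin; first by near=> n.
  by apply: (continuous_cvg _ _ ws); exact: cf.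
have Gdom_ae : \forall s \ae mu, forall n, setT s -> (`|G n s| <= dom s)%E.
  by apply: aeW => s n _; exact: Gdom.
have [iG _] := @dominated_convergence _ _ R mu setT measurableT G
  (fun s => kern gamma s * F (t0 - s)%R)%E dom mG
  (measurable_conv_integrand _ (nnm_kern _) nF) cvgG idom Gdom_ae.
move=> cvgint.
apply: fine_cvg; rewrite fineK; first exact: cvgint.
exact: integrable_fin_num iG.
Unshelve. all: by end_near. Qed.

End PointwiseVolterra.

Section Volterra.
Context {R : realType}.
Local Notation mu := (@lebesgue_measure R).
Implicit Types (gamma A p T t : R) (u : R -> R).

Lemma within_co_continuous u T t : {within `[0, T[, continuous u} ->
  0 < t < T -> {for t, continuous u}.
Proof.
move=> cu tT.
have : {within `]0, T[, continuous u}.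
  by apply: continuous_subspaceW cu => s /=; rewrite !in_itv/= => /andP[/ltW -> ->].
rewrite continuous_open_subspace; last exact: interval_open.
by apply; rewrite inE/= in_itv.
Qed.

(** Otherwise |u - u0| would stay above |u 0 - u0| / 2 near 0, and so would its
    averages. *)
Lemma has_right_limit_within u (u0 : R) T : 0 < T -> {within `[0, T[, continuous u} ->
  has_right_limit u u0 -> u 0 = u0.
Proof.
move=> T0 cu ulim; apply/eqP; apply: contraT => uu0.
pose d := `|u 0 - u0|; have d0 : 0 < d by rewrite normr_gt0 subr_eq0.
have cu0 : u x @[x --> 0^'+] --> u 0.
  have T2 : 0 < T / 2 by rewrite divr_gt0.
  have : {within `[0, T / 2], continuous u}.
    apply: continuous_subspaceW cu => s /=; rewrite !in_itv/= => /andP[-> sT]/=.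
    by rewrite (le_lt_trans sT)// ltr_pdivrMr// ltr_pMr// ltr1n.
  by move=> /(continuous_within_itvP _ T2)[].
have d2 : 0 < d / 2 by rewrite divr_gt0.
have /cvgrPdist_lt/(_ _ d2)[e /= e0 He] := cu0.
have He' s : 0 < s < e -> d / 2 <= `|u s - u0|.
  move=> /andP[s0 se]; have /= := He s; rewrite sub0r normrN gtr0_norm// => /(_ se s0).
  move=> us; have : d <= `|u 0 - u s| + `|u s - u0|.
    by rewrite (le_trans _ (ler_normD _ _))// addrA subrK.
  by rewrite /d in us *; lra.
move/fine_cvgP : ulim => [ufin /cvgrPdist_lt/(_ _ d2) ulim]; exfalso.
near (0 : R)^'+ => t.
have t0 : 0 < t by near: t; exact: nbhs_right_gt.
have te : t < e by near: t; exact: nbhs_right_lt.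
have tT : t < T by near: t; exact: nbhs_right_lt.
have mu_t : measurable_fun `]0, t[ (fun s => `|u s - u0|).
  apply: measurableT_comp => //; apply: measurable_funB => //.
  apply: open_continuous_measurable_fun; first exact: interval_open.
  move=> s; rewrite inE/= in_itv/= => /andP[s0 st].
  by apply: (within_co_continuous cu); rewrite s0 (lt_trans st).
have int_ge : ((d / 2 * t)%:E <= \int[mu]_(s in `]0%R, t[) `|u s - u0|%:E)%E.
  apply: (@le_trans _ _ (\int[mu]_(s in `]0%R, t[) (d / 2)%:E)%E).
    rewrite integral_cst//= lebesgue_measure_itv/= lte_fin t0.
    by rewrite -EFinB subr0 -EFinM.
  apply: ge0_le_integral => //.
  - by move=> s _; rewrite lee_fin ltW.
  - exact/measurable_EFinP.
  - move=> s /=; rewrite in_itv/= => /andP[s0 st].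
    by rewrite lee_fin He'// s0 (lt_trans st).
have : `|0 - fine ((t^-1)%:E * \int[mu]_(s in `]0%R, t[) `|u s - u0|%:E)%E| < d / 2.
  by near: t; exact: ulim.
have : ((t^-1)%:E * \int[mu]_(s in `]0%R, t[) `|u s - u0|%:E)%E \is a fin_num.
  by near: t; exact: ufin.
move=> Ifin; have : ((d / 2)%:E <= (t^-1)%:E * \int[mu]_(s in `]0%R, t[) `|u s - u0|%:E)%E.
  rewrite (_ : (d / 2)%:E = ((t^-1)%:E * (d / 2 * t)%:E)%E); last first.
    by rewrite -EFinM mulrCA mulVf ?mulr1// gt_eqF.
  by apply: lee_wpmul2l => //; rewrite lee_fin invr_ge0 ltW.
rewrite -[in X in X -> _](fineK Ifin) lee_fin sub0r normrN.
move=> h1 h2; have := lt_le_trans h2 h1; rewrite ltNge => /negP; apply.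
exact: ler_norm.
Unshelve. all: by end_near. Qed.

(** Both sides are continuous and have the same primitives. *)
Lemma volterra_of_strong gamma T M (f u : R -> R) (u0 : R) : 0 < gamma < 1 -> 0 <= u0 ->
  (forall t, 0 < t < T -> {for t, continuous u}) ->
  (forall t, 0 < t < T -> {for t, continuous (f \o u)}) ->
  (forall t, 0 < t < T -> 0 <= u t <= M) ->
  (forall t, 0 < t < T -> 0 <= f (u t) <= M) ->
  strong_solution gamma f u0 T u -> forall t, 0 < t < T ->
  ((u t)%:E = u0%:E + ((Gamma gamma)^-1)%:E *
    \int[mu]_(s in `]0%R, t[) (f (u s) * (t - s) `^ (gamma - 1))%:E)%E.
Proof.
move=> gamma01 u00 cu cfu uM fuM sol t tT.
have /andP[g0 g1] := gamma01; have Gg0 := Gamma_gt0 g0.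
have mu_u : measurable_fun `]0, T[ u.
  apply: open_continuous_measurable_fun; first exact: interval_open.
  by move=> s; rewrite inE/= in_itv/=; exact: cu.
have mfu : measurable_fun `]0, T[ (f \o u).
  apply: open_continuous_measurable_fun; first exact: interval_open.
  by move=> s; rewrite inE/= in_itv/=; exact: cfu.
have M0 : 0 <= M by have /andP[] := uM _ tT; exact: le_trans.
have T0 : 0 < T by case/andP : tT; exact: lt_trans.
have intV := integrated_volterra gamma01 u00 mu_u mfu uM fuM sol.
set F := trunc T (f \o u) in intV.
have nF : nnm F by apply: nnm_trunc => // s /fuM/andP[].
have nFk : nnm (conv F (kern gamma)) by apply: nnm_conv => //; exact: nnm_kern.
have Fk_fin s : conv F (kern gamma) s \is a fin_num.
  exact: (conv_trunc_kern_fin_num _ g0 M0 mfu fuM).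
pose V s := fine (conv F (kern gamma) s).
have VE s : (V s)%:E = conv F (kern gamma) s by rewrite /V fineK.
have V_le s : s <= T -> V s <= M * (gamma^-1 * T `^ gamma).
  move=> sT; rewrite -lee_fin VE.
  apply: le_trans (conv_trunc_kern_le _ g0 M0 mfu fuM) _; rewrite !EFinM.
  apply: lee_wpmul2l; first by rewrite lee_fin.
  apply: lee_wpmul2l; first by rewrite lee_fin invr_ge0 ltW.
  have [s0|s0] := leP s 0; first by rewrite kern_le0// lee_fin powR_ge0.
  by rewrite kern_gt0// addrK lee_fin ge0_ler_powR ?nnegrE ?(ltW g0) ?(ltW s0) ?(ltW T0).
have V0 s : 0 <= V s by rewrite fine_ge0 ?nFk.2.
have mV : measurable_fun setT V by apply: measurableT_comp => //; exact: nFk.1.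
have cV : forall s, 0 < s < T -> {for s, continuous V}.
  exact: (continuous_conv_kern g0 mfu fuM cfu).
have prim s : 0 < s < T -> \int[mu]_(x in `]0, s[) (Gamma gamma * u x) =
    \int[mu]_(x in `]0, s[) (Gamma gamma * u0 + V x).
  move=> /andP[s0 sT]; have := intV _ sT.
  have lt_T x : x \in `]0, s[%classic -> 0 < x < T.
    by rewrite inE/= in_itv/= => /andP[-> /lt_trans]; exact.
  have sub : `]0, s[ `<=` `]0, T[ by move=> x /mem_set/lt_T; rewrite /= in_itv.
  rewrite !conv_kern1_causal; last 3 first.
  - move=> x x0; apply: integral0_eq => y _.
    have [y0|y0] := leP y 0; first by rewrite /F trunc0 ?mul0e// ltNge y0.
    by rewrite kern_le0 ?mule0//; lra.
  - by move=> x x0; rewrite trunc0// ltNge x0.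
  - by move=> x x0; rewrite trunc0// ltNge x0.
  move=> E.
  rewrite /Rintegral; congr fine.
  have mS (W : R -> \bar R) : nnm W -> measurable_fun `]0, s[ W.
    by move=> nW; apply: measurable_funTS; exact: nW.1.
  have nU : nnm (trunc T u) by apply: nnm_trunc => // x /uM/andP[].
  have nU0 : nnm (trunc T (cst u0)) by exact: nnm_trunc.
  transitivity ((Gamma gamma)%:E * \int[mu]_(x in `]0%R, s[) trunc T u x)%E.
    rewrite -ge0_integralZl ?lee_fin ?ltW//; last 2 first.
    - exact: mS.
    - by move=> x _; exact: nU.2.
    by apply: eq_integral => x /lt_T xT; rewrite truncE.
  rewrite E -ge0_integralZl ?lee_fin ?(ltW Gg0)//; last 2 first.
  - exact: mS.
  - by move=> x _; exact: nU0.2.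
  rewrite -ge0_integralD//; last 4 first.
  - by move=> x _; rewrite mule_ge0 ?nU0.2// lee_fin ltW.
  - by apply: emeasurable_funM => //; exact: mS.
  - by move=> x _; exact: nFk.2.
  - exact: mS.
  by apply: eq_integral => x /lt_T xT; rewrite truncE// EFinD VE.
have := @eq_of_primitives R (fun s => Gamma gamma * u s)
  (fun s => Gamma gamma * u0 + V s) T _ _ _ _ prim _ tT.
move=> H.
have -> : u t = u0 + (Gamma gamma)^-1 * V t.
  rewrite -[u t](mulKf (lt0r_neq0 Gg0)) H.
  - by rewrite mulrDr mulKf// gt_eqF.
  - apply: (@bounded_integrable_oo _ _ _ (Gamma gamma * M)); first exact: measurable_funM.
    move=> s /uM/andP[us0 usM].
    by rewrite ger0_norm ?mulr_ge0 ?(ltW Gg0)// ler_pM2l.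
  - apply: (@bounded_integrable_oo _ _ _ (Gamma gamma * u0 + M * (gamma^-1 * T `^ gamma))).
      by apply: measurable_funD => //; apply: measurable_funTS.
    move=> s /andP[_ sT]; rewrite ger0_norm ?addr_ge0 ?mulr_ge0 ?(ltW Gg0)// lerD2l.
    exact/V_le/ltW.
  - by move=> s sT; apply: cvgMr; exact: cu.
  - by move=> s sT; apply: cvgD; [exact: cvg_cst|exact: cV].
rewrite EFinD EFinM VE conv_kern_causal; last first.
  by move=> s s0; rewrite /F trunc0// ltNge s0.
congr (_ + _ * _)%E; have /andP[t0 t_T] := tT.
apply: eq_integral => s; rewrite inE/= in_itv/= => /andP[s0 st].
by rewrite /F truncE ?s0 ?(lt_trans st).
Qed.

End Volterra.

(** * The power nonlinearity and tools for its Volterra equation *)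

Section PowerVolterra.
Context {R : realType}.
Local Notation mu := (@lebesgue_measure R).
Implicit Types (gamma A p T t : R) (u g : R -> R).

Lemma power_solution_volterra gamma A p (u0 : R) T u :
  0 < gamma < 1 -> 0 < A -> 0 <= p -> 0 < u0 -> power_solution gamma A p u0 T u ->
  forall t, 0 < t < T ->
  ((u t)%:E = u0%:E + (A / Gamma gamma)%:E *
    \int[mu]_(s in `]0%R, t[) (u s `^ p * (t - s) `^ (gamma - 1))%:E)%E.
Proof.
move=> gamma01 A0 p0 u00 [cu u_gt0 sol] t /andP[t0 tT].
have /andP[g0 _] := gamma01; have Gg0 := Gamma_gt0 g0.
have [T1 /andP[tT1 T1T]] : exists T1, t < T1 < T.
  by exists ((t + T) / 2); rewrite !(midf_lt tT).
have T1_gt0 : 0 < T1 by exact: lt_trans tT1.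
have cu1 : {within `[0, T1], continuous u}.
  apply: continuous_subspaceW cu => s /=; rewrite !in_itv/= => /andP[-> /le_lt_trans].
  exact.
have [m m01 um] := EVT_max (ltW T1_gt0) cu1.
have in01 s : 0 < s < T1 -> 0 < s < T by move=> /andP[-> /lt_trans]; exact.
have us s : 0 < s < T1 -> 0 < u s <= u m.
  move=> sT; have /andP[s0 sT1] := sT; rewrite u_gt0 ?um//.
    by rewrite in_itv/= !ltW.
  by rewrite ltW//=; have /andP[] := in01 _ sT.
have um0 : 0 < u m by have /us/andP[] : 0 < t < T1; [rewrite t0|exact: lt_le_trans].
have cs s : 0 < s < T1 -> {for s, continuous u}.
  by move=> sT; exact: (within_co_continuous cu (in01 _ sT)).
rewrite (volterra_of_strong (M := Num.max (u m) (A * u m `^ p)) gamma01 (ltW u00)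
  cs _ _ _ (sol _ _)) ?t0 ?T1_gt0//=; last 3 first.
- move=> s sT; apply: cvgMr.
  apply: (@continuous_comp _ _ _ u (fun x => x `^ p)); first exact: cs.
  apply: differentiable_continuous; apply/derivable1_diffP.
  by apply: derivable_powR; rewrite in_itv/= andbT; have /andP[] := us _ sT.
- by move=> s /us/andP[us0 usm]; rewrite le_max usm ltW.
- move=> s /us/andP[us0 usm]; apply/andP; split.
    by rewrite mulr_ge0 ?powR_ge0// ltW.
  rewrite le_max; apply/orP; right.
  by rewrite ler_pM2l// ge0_ler_powR ?nnegrE ?(ltW us0) ?(ltW um0).
congr (_ + _)%E; rewrite mulrC EFinM -muleA; congr (_ * _)%E.
rewrite -ge0_integralZl ?lee_fin ?ltW//.
- by apply: eq_integral => s _; rewrite -EFinM mulrA.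
- apply/measurable_EFinP; apply: measurable_funM; last first.
    apply: (measurableT_comp (measurable_powR _)).
    by apply: measurable_funTS; exact: measurable_funB.
  apply: (measurableT_comp (measurable_powR _)).
  apply: open_continuous_measurable_fun; first exact: interval_open.
  move=> s; rewrite inE/= in_itv/= => /andP[s0 st]; apply: cs.
  by rewrite s0 (lt_trans st).
- by move=> s _; rewrite lee_fin mulr_ge0 ?powR_ge0.
Qed.

Lemma power_solution0 gamma A p (u0 : R) T u : 0 < T ->
  power_solution gamma A p u0 T u -> u 0 = u0.
Proof.
move=> T0 [cu _ sol].
have [|_ ulim _] := sol (T / 2).
  by rewrite divr_gt0//= ltr_pdivrMr// ltr_pMr// ltr1n.
exact: has_right_limit_within cu ulim.
Qed.

(** Real induction: a continuous function cannot stop being positive at a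
    first time if positivity before t entails positivity at t. *)
Lemma continuous_pos_ind g T : {within `[0, T[, continuous g} ->
  (forall t, 0 <= t < T -> (forall s, 0 <= s < t -> 0 < g s) -> 0 < g t) ->
  forall t, 0 <= t < T -> 0 < g t.
Proof.
move=> cg step t1 t1T; rewrite ltNge; apply/negP => gt1.
have /andP[t1_ge0 t1_lt] := t1T.
pose S := [set t | 0 <= t <= t1 /\ forall s, 0 <= s <= t -> 0 < g s].
have S0 : S 0.
  split; first by rewrite lexx.
  move=> s; rewrite -eq_le => /eqP <-; apply: step; first by rewrite lexx (le_lt_trans t1_ge0).
  by move=> r; rewrite le_lt_asym.
have ubS : ubound S t1 by move=> t [/andP[]].
have supS : has_sup S by split; [exists 0|exists t1].
pose m := sup S.
have m0 : 0 <= m by exact: sup_upper_bound.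
have mt1 : m <= t1 by apply: ge_sup => //; exists 0.
have mT : m < T by exact: le_lt_trans t1_lt.
have before s : 0 <= s < m -> 0 < g s.
  move=> /andP[s0 sm]; have [t [_ gt] st] := sup_gt (ex_intro _ _ S0) sm.
  by apply: gt; rewrite s0 ltW.
have gm : 0 < g m by apply: step => //; rewrite m0.
have /subspace_continuousP/(_ m) := cg.
rewrite /= in_itv/= m0 mT => /(_ isT)/cvgrPdist_lt/(_ _ gm).
rewrite near_withinE => -[e /= e0 He].
have near_m s : 0 <= s < T -> `|m - s| < e -> 0 < g s.
  move=> sT ms; have := He s ms; rewrite /= in_itv/= => /(_ sT).
  by rewrite ltr_distlC => /andP[]; rewrite subrr.
have upto s : 0 <= s < T -> s < m + e -> 0 < g s.
  move=> /andP[s0 sT] sme; have [sm|ms] := ltP s m; first by apply: before; rewrite s0.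
  by apply: near_m; rewrite ?s0// distrC ger0_norm ?subr_ge0// ltrBlDl.
have [t1e|t1e] := ltP t1 (m + e); first by move: gt1; rewrite leNgt upto.
have : S (m + e / 2).
  split; first by apply/andP; split; lra.
  by move=> s /andP[s0 sm]; apply: upto; [rewrite s0/=; lra|lra].
move=> /(sup_upper_bound supS); rewrite -/m; lra.
Qed.

Lemma is_derive_comp_powR (f : R -> R) (a t d : R) : 0 < f t ->
  is_derive t 1 f d ->
  is_derive t 1 (fun x => f x `^ a) (a * f t `^ (a - 1) * d).
Proof.
move=> ft df.
have dpow : is_derive (f t) 1 (fun x : R => x `^ a) (a * f t `^ (a - 1)) :=
  is_derive1_powR a ft.
exact: (@is_derive1_comp _ (fun x : R => x `^ a) f t _ _ dpow df).
Qed.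

Lemma powRN_nincr (a x y : R) : 0 <= a -> 0 < x -> x <= y ->
  y `^ (- a) <= x `^ (- a).
Proof.
move=> a0 x0 xy; have y0 : 0 < y by exact: lt_le_trans xy.
rewrite !powRN lef_pV2 ?posrE ?powR_gt0//.
by rewrite ge0_ler_powR ?nnegrE ?(ltW x0) ?(ltW y0).
Qed.

(** Integrate (k' - k) (f - m) >= 0: the two terms in m cancel. *)
Lemma le_integral_correlated (D : set R) (f k k' : R -> R) (m J : R) :
  measurable D -> measurable_fun D f -> measurable_fun D k -> measurable_fun D k' ->
  (forall s, D s -> 0 <= f s) -> (forall s, D s -> 0 <= k s) ->
  (forall s, D s -> 0 <= k' s) -> 0 <= m ->
  (forall s, D s -> 0 <= (k' s - k s) * (f s - m)) ->
  (\int[mu]_(s in D) (k s)%:E = J%:E)%E -> (\int[mu]_(s in D) (k' s)%:E = J%:E)%E ->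
  (\int[mu]_(s in D) (f s * k s)%:E <= \int[mu]_(s in D) (f s * k' s)%:E)%E.
Proof.
move=> mD mf mk mk' f0 k0 k'0 m0 corr kJ k'J.
have intZ (h : R -> R) : measurable_fun D h -> (forall s, D s -> 0 <= h s) ->
    (\int[mu]_(s in D) (m * h s)%:E = m%:E * \int[mu]_(s in D) (h s)%:E)%E.
  move=> mh h0; rewrite -ge0_integralZl ?lee_fin//.
  by apply/measurable_EFinP.
have intD (a b : R -> R) : measurable_fun D a -> measurable_fun D b ->
    (forall s, D s -> 0 <= a s) -> (forall s, D s -> 0 <= b s) ->
    (\int[mu]_(s in D) (a s + b s)%:E =
     \int[mu]_(s in D) (a s)%:E + \int[mu]_(s in D) (b s)%:E)%E.
  move=> ma mb a0 b0; rewrite -ge0_integralD//; exact/measurable_EFinP.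
have mM (a b : R -> R) : measurable_fun D a -> measurable_fun D b ->
    measurable_fun D (fun s => a s * b s) by exact: measurable_funM.
have mZ (b : R -> R) : measurable_fun D b -> measurable_fun D (fun s => m * b s).
  by move=> mb; exact: measurable_funM.
have : (\int[mu]_(s in D) (f s * k s + m * k' s)%:E <=
        \int[mu]_(s in D) (f s * k' s + m * k s)%:E)%E.
  apply: ge0_le_integral => //.
  - by move=> s Ds; rewrite lee_fin addr_ge0// mulr_ge0 ?f0 ?k0 ?k'0.
  - by apply/measurable_EFinP; apply: measurable_funD; [exact: mM|exact: mZ].
  - by apply/measurable_EFinP; apply: measurable_funD; [exact: mM|exact: mZ].
  - by move=> s /corr; rewrite lee_fin; lra.
rewrite intD ?intD; [|exact: mM|exact: mZ| | |exact: mM|exact: mZ| |].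
- by rewrite !intZ// kJ k'J leeD2rE// -EFinM.
- by move=> s Ds; rewrite mulr_ge0 ?f0 ?k'0.
- by move=> s Ds; rewrite mulr_ge0 ?k0.
- by move=> s Ds; rewrite mulr_ge0 ?f0 ?k0.
- by move=> s Ds; rewrite mulr_ge0 ?k'0.
Qed.

Lemma integral_kernel gamma (a t : R) : 0 < gamma -> a < t ->
  (\int[mu]_(s in `]a, t[) ((t - s) `^ (gamma - 1))%:E =
   ((t - a) `^ gamma / gamma)%:E)%E.
Proof.
move=> g0 at_; rewrite -conv_kern1 ?subr_gt0//.
rewrite convC; [|exact: nnm_kern|exact: nnm_kern].
rewrite /conv (@ge0_integral_affine R 1 (- a)) ?oner_eq0//; last 2 first.
- by apply: measurable_conv_integrand; exact: nnm_kern.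
- by move=> s; rewrite mule_ge0 ?(nnm_kern _).2.
rewrite normr1 mul1e integral_mkcond; apply: eq_integral => s _.
rewrite patchE mul1r opprD opprK addrA addrAC subrK.
case: ifPn; rewrite ?inE ?notin_setE /= in_itv/=.
  move=> /andP[as_ st]; rewrite !kern_gt0 ?subr_gt0// subrr powRr0 mul1e.
  by congr (_ `^ _)%:E; ring.
move=> /negP; rewrite negb_and -!leNgt => /orP[s0|ts].
  by rewrite kern_le0 ?mul0e ?subr_le0.
rewrite (@kern_le0 _ gamma) ?mule0//; lra.
Qed.

End PowerVolterra.

(** * Bounds on the blow-up time of a Volterra solution *)

Section BlowUpBounds.
Context {R : realType}.
Local Notation mu := (@lebesgue_measure R).
Variables (gamma c p u0 T : R) (u : R -> R).
Hypotheses (gamma01 : 0 < gamma < 1) (c0 : 0 < c) (p1 : 1 < p) (u0_gt0 : 0 < u0)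
  (T0 : 0 < T).
Hypotheses (cu : {within `[0, T[, continuous u}) (u00 : u 0 = u0)
  (u_gt0 : forall t, 0 <= t < T -> 0 < u t).
Hypothesis volterra : forall t, 0 < t < T ->
  ((u t)%:E = u0%:E + c%:E *
    \int[mu]_(s in `]0%R, t[) (u s `^ p * (t - s) `^ (gamma - 1))%:E)%E.
Hypothesis blow_up : u t @[t --> T^'-] --> +oo.

Let g0 : 0 < gamma. Proof. by have /andP[] := gamma01. Qed.
Let p0 : 0 < p. Proof. exact: lt_trans p1. Qed.
Let q0 : 0 < p - 1. Proof. by rewrite subr_gt0. Qed.
Let C := c / gamma.
Let C0 : 0 < C. Proof. exact: divr_gt0. Qed.
Let CM0 m : 0 <= C * m `^ p.
Proof. by apply: mulr_ge0 (powR_ge0 _ _); exact: ltW. Qed.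

Let u_unbounded M : exists2 t, 0 <= t < T & M < u t.
Proof.
near T^'- => t; exists t; last by near: t; move/cvgryPgt : blow_up; exact.
by apply/andP; split; near: t; [exact: nbhs_left_ge|exact: nbhs_left_lt].
Unshelve. all: by end_near. Qed.

Let measurable_kernel (t : R) (D : set R) :
  measurable_fun D (fun s => (t - s) `^ (gamma - 1)).
Proof.
apply: (measurableT_comp (measurable_powR _)).
by apply: measurable_funTS; exact: measurable_funB.
Qed.

Let measurable_u_pow t : t <= T -> measurable_fun `]0, t[ (fun s => u s `^ p).
Proof.
move=> tT; apply: (measurableT_comp (measurable_powR _)).
apply: open_continuous_measurable_fun; first exact: interval_open.
move=> s; rewrite inE/= in_itv/= => /andP[s0 st].
by apply: (within_co_continuous cu); rewrite s0 (lt_le_trans st).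
Qed.

Let u_itv s t : t < T -> 0 < s < t -> 0 < u s.
Proof. by move=> tT /andP[s0 st]; rewrite u_gt0// ltW//= (lt_trans st). Qed.

(** The Volterra equation turns a bound on the past of u into a bound on u t;
    here and below C stands for c / gamma because the kernel integrates to
    t^gamma / gamma. *)
Let volterra_le (M t : R) : 0 < t < T -> (forall s, 0 < s < t -> u s <= M) ->
  u t <= u0 + C * M `^ p * t `^ gamma.
Proof.
move=> tT uM; have /andP[t0 t_T] := tT.
have M0 : 0 <= M.
  have ht : 0 < t / 2 < t by apply/andP; split; lra.
  by rewrite (le_trans _ (uM _ ht))// ltW// (u_itv t_T).
rewrite -lee_fin volterra// EFinD leeD2l//.
apply: (@le_trans _ _ (c%:E * \int[mu]_(s in `]0%R, t[) ((M `^ p)%:E * ((t - s) `^ (gamma - 1))%:E))%E).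
  apply: lee_wpmul2l; first by rewrite lee_fin ltW.
  apply: ge0_le_integral => //.
  - by move=> s _; rewrite lee_fin mulr_ge0 ?powR_ge0.
  - apply/measurable_EFinP; apply: measurable_funM; last exact: measurable_kernel.
    by apply: measurable_u_pow; exact: ltW.
  - by apply/measurable_EFinP; apply: measurable_funM => //; exact: measurable_kernel.
  - move=> s /=; rewrite in_itv/= => st; rewrite lee_fin ler_wpM2r ?powR_ge0//.
    by rewrite ge0_ler_powR ?nnegrE ?uM ?(ltW p0)// ltW// (u_itv t_T).
rewrite ge0_integralZl ?lee_fin ?powR_ge0//; last first.
- by move=> s _; rewrite lee_fin powR_ge0.
- by apply/measurable_EFinP; exact: measurable_kernel.
rewrite integral_kernel// subr0 -!EFinM lee_fin.
by rewrite le_eqVlt; apply/orP; left; apply/eqP; rewrite /C; ring.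
Qed.

(** If the inequality failed, then by the previous bound u could never reach M,
    whereas it blows up. *)
Lemma blow_up_ge (M : R) : u0 < M -> M - u0 <= C * M `^ p * T `^ gamma.
Proof.
move=> u0M; rewrite leNgt; apply/negP => CM.
have M0 : 0 < M by exact: lt_trans u0M.
have uM : forall t, 0 <= t < T -> 0 < M - u t.
  apply: continuous_pos_ind.
    by move=> t; apply: cvgB; [exact: cvg_cst|exact: cu].
  move=> t /andP[]; rewrite le_eqVlt => /predU1P[<- _ _|t0 tT before].
    by rewrite u00 subr_gt0.
  have tT' : 0 < t < T by rewrite t0.
  have le_M s : 0 < s < t -> u s <= M.
    by move=> /andP[s0 st]; rewrite -subr_ge0 ltW// before// ltW.
  rewrite subr_gt0 (le_lt_trans (volterra_le tT' le_M))//.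
  rewrite -ltrBrDl (le_lt_trans _ CM)// (ler_wpM2l (CM0 _))//.
  by rewrite ge0_ler_powR ?nnegrE ?(ltW g0) ?(ltW t0) ?(ltW T0) ?(ltW tT).
have [t tT] := u_unbounded M.
by rewrite ltNge ltW// -subr_gt0 uM.
Qed.

(** Only the history after tau is kept. *)
Let volterra_ge (m tau t : R) : 0 <= m -> 0 <= tau < t -> t < T ->
  (forall s, tau < s < t -> m <= u s) ->
  C * m `^ p * (t - tau) `^ gamma <= u t.
Proof.
move=> m0 /andP[tau0 taut] tT mu_.
have t0 : 0 < t by exact: le_lt_trans taut.
rewrite -lee_fin volterra ?t0//.
apply: (@le_trans _ _ (c%:E * \int[mu]_(s in `]0%R, t[) (u s `^ p * (t - s) `^ (gamma - 1))%:E)%E); last first.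
  by rewrite leeDr// lee_fin ltW.
apply: (@le_trans _ _ (c%:E * \int[mu]_(s in `]tau, t[) ((m `^ p)%:E * ((t - s) `^ (gamma - 1))%:E))%E).
  rewrite ge0_integralZl ?lee_fin ?powR_ge0//; last first.
  - by move=> s _; rewrite lee_fin powR_ge0.
  - by apply/measurable_EFinP; exact: measurable_kernel.
  rewrite integral_kernel// -!EFinM lee_fin.
  by rewrite le_eqVlt; apply/orP; left; apply/eqP; rewrite /C; ring.
apply: lee_wpmul2l; first by rewrite lee_fin ltW.
have sub : `]tau, t[ `<=` `]0, t[.
  by move=> s /=; rewrite !in_itv/= => /andP[/(le_lt_trans tau0) -> ->].
have mI : measurable_fun `]0, t[ (EFin \o (fun s => u s `^ p * (t - s) `^ (gamma - 1))).
  apply/measurable_EFinP; apply: measurable_funM; last exact: measurable_kernel.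
  by apply: measurable_u_pow; exact: ltW.
apply: (@le_trans _ _ (\int[mu]_(s in `]tau, t[) (u s `^ p * (t - s) `^ (gamma - 1))%:E)%E); last first.
  apply: ge0_subset_integral => //.
  by move=> s _; rewrite lee_fin mulr_ge0 ?powR_ge0.
apply: ge0_le_integral => //.
- by move=> s _; rewrite mule_ge0// lee_fin powR_ge0.
- by apply/measurable_EFinP; apply: measurable_funM => //; exact: measurable_kernel.
- exact: measurable_funS mI.
- move=> s /=; rewrite in_itv/= => st; rewrite lee_fin ler_wpM2r ?powR_ge0//.
  have /andP[s1 s2] := st.
  rewrite ge0_ler_powR ?nnegrE ?mu_ ?(ltW p0)// ltW// (u_itv tT)// s2 andbT.
  exact: le_lt_trans s1.
Qed.

Let u_ge_u0 t : 0 <= t < T -> u0 <= u t.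
Proof.
move=> /andP[]; rewrite le_eqVlt => /predU1P[<- _|t0 tT]; first by rewrite u00.
rewrite -lee_fin volterra ?t0// leeDl//.
apply: mule_ge0; first by rewrite lee_fin ltW.
by apply: integral_ge0 => s _; rewrite lee_fin mulr_ge0 ?powR_ge0.
Qed.

(** If u were defined at S, then u >= u0 2^(b n) after the time S (1 - 2^-n),
    for every n, with b = gamma / (p - 1): over the n-th interval, of length
    S 2^-(n + 1), the Volterra equation gains the factor
    C (u0 2^(b n))^(p - 1) (S 2^-(n + 1))^gamma, in which the powers of 2^n cancel
    by the choice of b, and what remains is at least 2^b by assumption.  So no
    real number could be the value of u at S. *)
Lemma blow_up_le_doubling (S : R) : 0 < S ->
  2 `^ (p * gamma / (p - 1)) <= C * u0 `^ (p - 1) * S `^ gamma -> T <= S.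
Proof.
move=> S0 HS; rewrite leNgt; apply/negP => ST.
pose b := gamma / (p - 1).
have b0 : 0 < b by exact: divr_gt0.
pose t n : R := S * (1 - 2^-1 ^+ n).
pose a n : R := u0 * 2 `^ (b * n%:R).
have h1 n : 0 < (2^-1 : R) ^+ n <= 1 by rewrite exprn_gt0//= exprn_ile1//; lra.
have t_ge0 n : 0 <= t n by rewrite mulr_ge0 ?subr_ge0 ?(ltW S0)//; case/andP : (h1 n).
have t_lt n : t n < S.
  by rewrite /t gtr_pMr// ltrBlDr ltrDl; case/andP : (h1 n).
have a_ge0 n : 0 <= a n by rewrite mulr_ge0 ?powR_ge0// ltW.
have claim n s : t n <= s < T -> a n <= u s.
  elim: n s => [|n IH] s /andP[ts sT].
    rewrite /a mulr0 powRr0 mulr1 u_ge_u0// sT andbT (le_trans _ ts)//.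
  have tn : t n < t n.+1.
    rewrite /t ltr_pM2l// ltrD2l ltrN2 exprS; have /andP[+ _] := h1 n; lra.
  have tns : t n < s by exact: lt_le_trans ts.
  apply: le_trans (volterra_ge (a_ge0 n) (_ : 0 <= t n < s) sT _); last 2 first.
  - by rewrite t_ge0.
  - by move=> r /andP[r1 r2]; rewrite IH// ltW//= (lt_trans r2).
  apply: (@le_trans _ _ (C * a n `^ p * (t n.+1 - t n) `^ gamma)); last first.
    rewrite (ler_wpM2l (CM0 _))//.
    rewrite ge0_ler_powR ?nnegrE ?(ltW g0) ?subr_ge0 ?(ltW tn) ?(ltW tns)//.
    by rewrite lerD2r.
  have -> : t n.+1 - t n = S * 2 `^ (- n.+1%:R).
    by rewrite powR_invn// -exprVn /t !exprS; field.
  rewrite /a !powRM ?powR_ge0 ?(ltW S0) ?(ltW u0_gt0)// -!powRrM.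
  rewrite -[u0 `^ p]mulr_powRB1 ?(ltW u0_gt0)//.
  have -> : C * (u0 * u0 `^ (p - 1) * 2 `^ (b * n%:R * p)) *
      (S `^ gamma * 2 `^ (- n.+1%:R * gamma)) =
      u0 * ((C * u0 `^ (p - 1) * S `^ gamma) *
        (2 `^ (b * n%:R * p) * 2 `^ (- n.+1%:R * gamma))) by ring.
  rewrite ler_pM2l//; apply: le_trans (ler_wpM2r _ HS); last by rewrite mulr_ge0 ?powR_ge0.
  rewrite -!powRD ?pnatr_eq0 ?implybT//.
  rewrite le_eqVlt; apply/orP; left; apply/eqP; congr (_ `^ _).
  by rewrite /b -natr1; field; rewrite gt_eqF.
have SS : 0 <= S < T by rewrite ltW.
have unb n : b * n%:R * ln 2 <= u S / u0 :> R.
  have := claim n S; rewrite (ltW (t_lt n)) ST => /(_ isT).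
  rewrite /a mulrC -ler_pdivlMr// => /(le_trans _); apply.
  rewrite /powR pnatr_eq0/= (le_trans _ (expR_ge1Dx _))//.
  by rewrite lerDr.
have ln2 : 0 < ln 2 :> R by rewrite ln_gt0// ltr1n.
have bl : 0 < b * ln 2 by exact: mulr_gt0.
have := unb (Num.bound (u S / u0 / (b * ln 2))).
rewrite mulrAC -ler_pdivlMl// leNgt => /negP; apply.
rewrite mulrC; apply: archi_boundP.
by rewrite divr_ge0 ?(ltW bl)// divr_ge0 ?(ltW u0_gt0)// ltW// u_gt0.
Qed.

(** Chebyshev's correlation inequality: the kernel s |-> (t - s)^(gamma - 1)
    increases with s, hence weighs a nondecreasing function at least as much as
    its mirror image s^(gamma - 1) does.  Both the difference of the two kernels
    and f s - f (t / 2) have the sign of s - t / 2. *)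
Let le_integral_mirror (t : R) (f : R -> R) : 0 < t ->
  measurable_fun `]0, t[ f -> (forall s, 0 < s < t -> 0 <= f s) ->
  (forall r s, 0 < r -> r <= s -> s < t -> f r <= f s) ->
  (\int[mu]_(s in `]0%R, t[) (f s * s `^ (gamma - 1))%:E <=
   \int[mu]_(s in `]0%R, t[) (f s * (t - s) `^ (gamma - 1))%:E)%E.
Proof.
move=> t0 mf f0 ndf; pose k s := s `^ (gamma - 1).
have t2 : 0 < t / 2 < t by apply/andP; split; lra.
have mk : measurable_fun `]0, t[ k.
  by apply: measurable_funTS; exact: measurable_powR.
have mk' : measurable_fun `]0, t[ (fun s : R => k (t - s)).
  exact: measurable_kernel.
have k_int : (\int[mu]_(s in `]0%R, t[) (k s)%:E = (t `^ gamma / gamma)%:E)%E.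
  by rewrite integral_itv_bndo_bndc; [exact: integral_powRB1|by apply/measurable_EFinP].
have k_int' : (\int[mu]_(s in `]0%R, t[) (k (t - s)%R)%:E = (t `^ gamma / gamma)%:E)%E.
  by have := integral_kernel g0 t0; rewrite subr0.
have k_nincr x y : 0 < x -> x <= y -> k y <= k x.
  by move=> x0 xy; rewrite /k -[gamma - 1]opprB powRN_nincr//; move: gamma01; lra.
apply: (le_integral_correlated (m := f (t / 2)) _ mf mk mk' _ _ _ _ _ k_int k_int').
- exact: measurable_itv.
- by move=> s /=; rewrite in_itv; exact: f0.
- by move=> s _; exact: powR_ge0.
- by move=> s _; exact: powR_ge0.
- exact: f0.
move=> s /=; rewrite in_itv/= => /andP[s0 st].
have [st2|t2s] := leP s (t / 2).
  rewrite mulr_le0// ?subr_le0.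
    by apply: k_nincr => //; lra.
  by apply: ndf => //; case/andP : t2.
rewrite mulr_ge0// ?subr_ge0.
  by apply: k_nincr; lra.
by apply: ndf; [case/andP : t2|exact: ltW|].
Qed.

(** By the mirror inequality, a solution v of v' = c t^(gamma - 1) v^p is a
    subsolution of the Volterra equation. *)
Let comparison (S : R) (v : R -> R) : S < T ->
  (forall t, 0 < t < S -> 0 < v t) ->
  (forall r s, 0 < r -> r <= s -> s < S -> v r <= v s) ->
  (forall t, 0 < t < S -> is_derive t 1 v (c * (v t `^ p * t `^ (gamma - 1)))) ->
  v x @[x --> 0^'+] --> v 0 -> v 0 < u0 ->
  forall t, 0 <= t < S -> v t < u t.
Proof.
move=> ST v_gt0 v_nd dv cv0 v0 t tS; rewrite -subr_gt0; move: t tS.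
have cv t : 0 < t < S -> {for t, continuous v}.
  by move=> /dv[dvt _]; apply: differentiable_continuous; exact/derivable1_diffP.
apply: continuous_pos_ind.
  move=> t; apply: cvgB.
    apply: (continuous_subspaceW _ cu) => s /=; rewrite !in_itv/= => /andP[-> /lt_trans].
    exact.
  move: t; apply/subspace_continuousP => z /=.
  rewrite in_itv/= => /andP[]; rewrite le_eqVlt => /predU1P[<-{z} _|z0 zS].
    apply: cvg_trans (cvg_at_right_within cv0); apply: cvg_app.
    by apply: within_subset => z/=; rewrite in_itv/= => /andP[].
  by apply: cvg_within_filter; apply: cv; rewrite z0.
move=> t /andP[]; rewrite le_eqVlt => /predU1P[<- _ _|t0 tS before].
  by rewrite u00 subr_gt0.
have tT : t < T by exact: lt_trans ST.
have in0S s : 0 < s < t -> 0 < s < S by move=> /andP[-> /lt_trans]; exact.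
have in0S' s : 0 < s <= t -> 0 < s < S by move=> /andP[-> /le_lt_trans]; exact.
have mvp : measurable_fun `]0, t[ (fun s => v s `^ p).
  apply: (measurableT_comp (measurable_powR _)).
  apply: open_continuous_measurable_fun; first exact: interval_open.
  by move=> s; rewrite inE/= in_itv/= => /in0S; exact: cv.
have mpow : measurable_fun `]0, t[ (fun s : R => s `^ (gamma - 1)).
  by apply: measurable_funTS; exact: measurable_powR.
have mvk : measurable_fun `]0, t[ (fun s => v s `^ p * s `^ (gamma - 1)).
  exact: measurable_funM.
have vge0 s : 0 < s < t -> 0 <= v s by move=> /in0S/v_gt0/ltW.
have FTC : (\int[mu]_(s in `]0%R, t]) (c * (v s `^ p * s `^ (gamma - 1)))%:E =
    (v t - v 0)%:E)%E.
  apply: ge0_FTC2_oc => //.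
  - move=> s _; apply: mulr_ge0; first exact: ltW.
    by apply: mulr_ge0; exact: powR_ge0.
  - move=> s /in0S' sS; have /andP[s0 _] := sS.
    have cpow (r y : R) : 0 < y -> {for y, continuous (fun x : R => x `^ r)}.
      move=> y0; apply: differentiable_continuous; apply/derivable1_diffP.
      by apply: derivable_powR; rewrite in_itv/= andbT.
    apply: cvgMr; apply: cvgM; last exact: cpow.
    apply: (@continuous_comp _ _ _ v (fun x : R => x `^ p)); first exact: cv.
    by apply: cpow; exact: v_gt0.
  - by move=> s /in0S'; exact: dv.
have mirror : (\int[mu]_(s in `]0%R, t[) (v s `^ p * s `^ (gamma - 1))%:E <=
    \int[mu]_(s in `]0%R, t[) (v s `^ p * (t - s) `^ (gamma - 1))%:E)%E.
  apply: (@le_integral_mirror t (fun s => v s `^ p) t0 mvp).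
    by move=> s _; exact: powR_ge0.
  move=> r s r0 rs st; apply: ge0_ler_powR; [exact: ltW| | |].
  - by rewrite nnegrE; apply: vge0; rewrite r0 (le_lt_trans rs).
  - by rewrite nnegrE; apply: vge0; rewrite (lt_le_trans r0).
  - by apply: v_nd => //; exact: lt_trans tS.
have le_u : (\int[mu]_(s in `]0%R, t[) (v s `^ p * (t - s) `^ (gamma - 1))%:E <=
    \int[mu]_(s in `]0%R, t[) (u s `^ p * (t - s) `^ (gamma - 1))%:E)%E.
  apply: ge0_le_integral => //.
  - by move=> s _; rewrite lee_fin; apply: mulr_ge0; exact: powR_ge0.
  - by apply/measurable_EFinP; apply: measurable_funM => //; exact: measurable_kernel.
  - apply/measurable_EFinP; apply: measurable_funM; last exact: measurable_kernel.
    by apply: measurable_u_pow; exact: ltW.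
  - move=> s /=; rewrite in_itv/= => st; have /andP[s0 st'] := st.
    rewrite lee_fin; apply: ler_wpM2r; first exact: powR_ge0.
    apply: ge0_ler_powR; [exact: ltW|by rewrite nnegrE vge0| |].
      by rewrite nnegrE; apply: ltW; exact: (u_itv tT).
    by rewrite -subr_ge0 ltW// before// ltW.
have vE : (c%:E * \int[mu]_(s in `]0%R, t[) (v s `^ p * s `^ (gamma - 1))%:E =
    (v t - v 0)%:E)%E.
  rewrite -FTC -integral_itv_bndo_bndc; last first.
    by apply/measurable_EFinP; apply: measurable_funM.
  rewrite -ge0_integralZl//.
  - exact/measurable_EFinP.
  - by move=> s _; rewrite lee_fin; apply: mulr_ge0; exact: powR_ge0.
  - by rewrite lee_fin ltW.
have : (u0%:E + (v t - v 0)%:E <= (u t)%:E)%E.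
  rewrite volterra ?t0// -vE; apply: leeD2l.
  apply: lee_wpmul2l; first by rewrite lee_fin ltW.
  exact: le_trans le_u.
by rewrite -EFinD lee_fin; move: v0; lra.
Qed.

(** The strict inequality on K puts the barrier below u at time 0; the
    comparison then keeps it below, up to its own blow-up time. *)
Let barrier_le (K S : R) : u0 `^ (1 - p) < K -> 0 < S ->
  (p - 1) * C * S `^ gamma = K -> T <= S.
Proof.
move=> u0K S0 SK; rewrite leNgt; apply/negP => ST.
have qC0 : 0 < (p - 1) * C by exact: mulr_gt0.
have K0 : 0 < K by rewrite -SK; apply: mulr_gt0 => //; exact: powR_gt0.
pose D t := K - (p - 1) * C * t `^ gamma.
(* The solution of v' = c t^(gamma - 1) v^p with v(0)^(1 - p) = K, by separation
   of variables; it blows up at S. *)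
pose v t := D t `^ (- (p - 1)^-1).
have D0 t : 0 <= t < S -> 0 < D t.
  move=> /andP[t0 tS]; rewrite /D subr_gt0 -SK ltr_pM2l//.
  by apply: gt0_ltr_powR; rewrite ?nnegrE// ltW.
have D_nd r s : 0 <= r -> r <= s -> D s <= D r.
  move=> r0 rs; rewrite /D lerB// ler_pM2l//; apply: ge0_ler_powR => //; first exact: ltW.
  by rewrite nnegrE (le_trans r0).
have dv t : 0 < t < S ->
    is_derive t 1 v (c * (v t `^ p * t `^ (gamma - 1))).
  move=> /andP[t0 tS]; have Dt : 0 < D t by apply: D0; rewrite ltW.
  have dD : is_derive t 1 D (- ((p - 1) * C * (gamma * t `^ (gamma - 1)))).
    have dZ : is_derive t 1 (fun x => (p - 1) * C * x `^ gamma)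
        ((p - 1) * C * (gamma * t `^ (gamma - 1))).
      exact: is_deriveZ (is_derive1_powR gamma t0).
    have := @is_deriveB _ _ _ (cst K) _ t 1 0 _ (is_derive_cst _ _ _) dZ.
    by rewrite sub0r.
  apply: (is_derive_eq (is_derive_comp_powR (- (p - 1)^-1) Dt dD)).
  rewrite /v -powRrM.
  have -> : - (p - 1)^-1 * p = - (p - 1)^-1 - 1 by field; rewrite gt_eqF.
  by rewrite /C; field; rewrite !gt_eqF.
have cv0 : v x @[x --> 0^'+] --> v 0.
  have D00 : 0 < D 0 by apply: D0; rewrite lexx.
  apply: (@continuous_cvg _ _ _ _ _ _ (fun x : R => x `^ (- (p - 1)^-1))).
    apply: differentiable_continuous; apply/derivable1_diffP.
    by apply: derivable_powR; rewrite in_itv/= andbT.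
  apply: cvgB; first exact: cvg_cst.
  by apply: cvgMr; rewrite powR0 ?gt_eqF//; exact: powR_cvg0.
have powV (x : R) : 0 <= x -> (x `^ (1 - p)) `^ (- (p - 1)^-1) = x.
  move=> x0; rewrite -powRrM (_ : (1 - p) * _ = 1) ?powRr1//.
  by field; rewrite gt_eqF.
have v0 : v 0 < u0.
  have -> : v 0 = K `^ (- (p - 1)^-1) by rewrite /v /D powR0 ?gt_eqF// mulr0 subr0.
  rewrite -[ltRHS]powV ?(ltW u0_gt0)// !powRN ltf_pV2 ?posrE ?powR_gt0//.
  by apply: gt0_ltr_powR => //; rewrite ?invr_gt0// nnegrE ?powR_ge0// ltW.
have below : forall t, 0 <= t < S -> v t < u t.
  apply: (comparison ST _ _ dv cv0 v0).
  - by move=> t /andP[t0 tS]; apply: powR_gt0; apply: D0; rewrite ltW.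
  - move=> r s r0 rs sS; apply: powRN_nincr; first by rewrite invr_ge0 ltW.
      by apply: D0; rewrite sS andbT ltW// (lt_le_trans r0).
    by apply: D_nd => //; exact: ltW.
have [m mS um] : exists2 m, m \in `[0, S] & forall t, t \in `[0, S] -> u t <= u m.
  apply: EVT_max; first exact: ltW.
  apply: (continuous_subspaceW _ cu) => s /=; rewrite !in_itv/= => /andP[-> /le_lt_trans].
  exact.
have um0 : 0 < u m.
  by apply: u_gt0; move: mS; rewrite in_itv/= => /andP[-> /le_lt_trans ->].
have um1 : 0 < u m + 1 by rewrite addr_gt0.
(* The time at which D = d, where v has exceeded the maximum of u on [0, S]. *)
pose d := Num.min (K / 2) ((u m + 1) `^ (1 - p)).
have d0 : 0 < d by rewrite lt_min divr_gt0//= powR_gt0.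
have dK : d < K by rewrite /d gt_min; apply/orP; left; lra.
have Kd : 0 < (K - d) / ((p - 1) * C) by apply: divr_gt0 => //; rewrite subr_gt0.
pose t := ((K - d) / ((p - 1) * C)) `^ gamma^-1.
have t0 : 0 < t by exact: powR_gt0.
have tE : (p - 1) * C * t `^ gamma = K - d.
  rewrite /t -powRrM mulVf ?gt_eqF// powRr1 ?(ltW Kd)//.
  by rewrite mulrC divfK// gt_eqF.
have tS : t < S.
  have : (p - 1) * C * t `^ gamma < (p - 1) * C * S `^ gamma by rewrite tE SK; lra.
  rewrite ltr_pM2l//; apply: contraTT; rewrite -!leNgt => St.
  by apply: ge0_ler_powR => //; rewrite ?nnegrE ltW.
have vt : u m + 1 <= v t.
  have -> : v t = d `^ (- (p - 1)^-1) by rewrite /v /D tE opprB addrC subrK.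
  rewrite -[leLHS]powV ?(ltW um1)//; apply: powRN_nincr => //.
    by rewrite invr_ge0 ltW.
  by rewrite /d ge_min lexx orbT.
have utm : u t <= u m by apply: um; rewrite in_itv/= !ltW.
have vtu : v t < u t by apply: below; rewrite (ltW t0).
by have := lt_le_trans (le_lt_trans vt vtu) utm; rewrite ltNge lerDl ler01.
Qed.

(** If this failed, the barrier for some K strictly between the two sides would
    blow up before T. *)
Lemma blow_up_le_barrier : (p - 1) * C * T `^ gamma <= u0 `^ (1 - p).
Proof.
rewrite leNgt; apply/negP => HT.
pose K := (u0 `^ (1 - p) + (p - 1) * C * T `^ gamma) / 2.
have qC0 : 0 < (p - 1) * C by exact: mulr_gt0.
have uK : u0 `^ (1 - p) < K by rewrite /K; lra.
have KT : K < (p - 1) * C * T `^ gamma by rewrite /K; lra.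
have K0 : 0 < K by rewrite (le_lt_trans _ uK)// powR_ge0.
pose S := (K / ((p - 1) * C)) `^ gamma^-1.
have S0 : 0 < S by rewrite powR_gt0// divr_gt0.
have SK : (p - 1) * C * S `^ gamma = K.
  rewrite /S -powRrM mulVf ?gt_eqF// powRr1; last by rewrite ltW// divr_gt0.
  by rewrite mulrC divfK// gt_eqF.
have := barrier_le uK S0 SK; rewrite leNgt => /negP; apply.
move: KT; rewrite -SK ltr_pM2l//; apply: contraTT; rewrite -!leNgt => TS.
by rewrite ge0_ler_powR ?nnegrE ?(ltW g0) ?(ltW T0) ?(ltW S0).
Qed.

End BlowUpBounds.

(** * Bounds on the blow-up time of the fractional equation *)

Section BlowUpTime.
Context {R : realType}.
Variables (A p gamma u0 Tb : R).
Hypotheses (A0 : 0 < A) (p1 : 1 < p) (gamma01 : 0 < gamma < 1) (u0_gt0 : 0 < u0).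
Hypothesis bTb : blow_up_time gamma A p u0 Tb.

Let g0 : 0 < gamma. Proof. by have /andP[] := gamma01. Qed.
Let p0 : 0 < p. Proof. exact: lt_trans p1. Qed.
Let q0 : 0 < p - 1. Proof. by rewrite subr_gt0. Qed.
Let G0 : 0 < Gamma (1 + gamma). Proof. by rewrite Gamma_gt0// addr_gt0. Qed.
Let T0 : 0 < Tb. Proof. by case: bTb. Qed.
Let Gg0 : 0 < Gamma gamma. Proof. exact: Gamma_gt0. Qed.

(** The functional equation of Gamma identifies the constant C = c / gamma. *)
Let CE : A / Gamma gamma / gamma = A / Gamma (1 + gamma).
Proof. by rewrite [1 + _]addrC GammaS//; field; rewrite !gt_eqF. Qed.

Let c0 : 0 < A / Gamma gamma. Proof. exact: divr_gt0. Qed.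

Let u0q : 0 < u0 `^ (p - 1). Proof. exact: powR_gt0. Qed.

Let u0pE : u0 `^ p = u0 * u0 `^ (p - 1).
Proof. by rewrite mulr_powRB1// ltW. Qed.

Let root_powR (X : R) : 0 <= X -> (X `^ gamma^-1) `^ gamma = X.
Proof. by move=> X0; rewrite -powRrM mulVf ?gt_eqF// powRr1. Qed.

Let TbE : (Tb `^ gamma) `^ gamma^-1 = Tb.
Proof. by rewrite -powRrM mulfV ?gt_eqF// powRr1 ?ltW. Qed.

Let blow_up_ge_of (g : R) : 0 < g ->
  1 <= A / Gamma (1 + gamma) * u0 `^ (p - 1) * g * Tb `^ gamma ->
  (Gamma (1 + gamma) / (A * u0 `^ (p - 1) * g)) `^ gamma^-1 <= Tb.
Proof.
move=> g_gt0 H; have d0 : 0 < A * u0 `^ (p - 1) * g by rewrite !mulr_gt0.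
have HX : Gamma (1 + gamma) / (A * u0 `^ (p - 1) * g) <= Tb `^ gamma.
  rewrite ler_pdivrMr// -[leLHS]mulr1; apply: le_trans (ler_wpM2l (ltW G0) H) _.
  rewrite le_eqVlt; apply/orP; left; apply/eqP; by field; rewrite !gt_eqF.
rewrite -[leRHS]TbE.
by rewrite ge0_ler_powR ?nnegrE ?invr_ge0 ?(ltW g0) ?powR_ge0// divr_ge0 ?(ltW G0) ?(ltW d0).
Qed.

Let blow_up_le_of (g : R) : 0 < g ->
  A / Gamma (1 + gamma) * u0 `^ (p - 1) * g * Tb `^ gamma <= 1 ->
  Tb <= (Gamma (1 + gamma) / (A * u0 `^ (p - 1) * g)) `^ gamma^-1.
Proof.
move=> g_gt0 H; have d0 : 0 < A * u0 `^ (p - 1) * g by rewrite !mulr_gt0.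
have HX : Tb `^ gamma <= Gamma (1 + gamma) / (A * u0 `^ (p - 1) * g).
  rewrite ler_pdivlMr// -[leRHS]mulr1; apply: le_trans (ler_wpM2l (ltW G0) H).
  rewrite le_eqVlt; apply/orP; left; apply/eqP; by field; rewrite !gt_eqF.
rewrite -[leLHS]TbE.
by rewrite ge0_ler_powR ?nnegrE ?invr_ge0 ?(ltW g0) ?powR_ge0// divr_ge0 ?(ltW G0) ?(ltW d0).
Qed.

Lemma G_const_gt0 : 0 < G_const p.
Proof. by rewrite lt_min powR_gt0//= divr_gt0// powR_gt0. Qed.

Lemma H_const_gt0 : 0 < H_const p gamma.
Proof. by rewrite lt_max q0. Qed.

(** The two terms of the minimum come from the levels M = 2 u0 and
    M = p u0 / (p - 1); the latter maximises (M - u0) / M^p. *)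
Lemma blow_up_time_ge :
  (Gamma (1 + gamma) / (A * u0 `^ (p - 1) * G_const p)) `^ gamma^-1 <= Tb.
Proof.
apply: blow_up_ge_of; first exact: G_const_gt0.
have [_ [u [[sol _] uoo]]] := bTb.
have lower M : u0 < M -> M - u0 <= A / Gamma (1 + gamma) * M `^ p * Tb `^ gamma.
  rewrite -CE; have [cu ugt0 _] := sol.
  apply: (blow_up_ge gamma01 c0 p1 u0_gt0 T0 cu (power_solution0 T0 sol) ugt0 _ uoo).
  exact: power_solution_volterra gamma01 A0 (ltW p0) u0_gt0 sol.
rewrite /G_const; case: (leP (2 `^ p)) => _.
  have /lower : u0 < 2 * u0 by rewrite ltr_pMl// ltr1n.
  rewrite powRM ?(ltW u0_gt0)// u0pE (_ : 2 * u0 - u0 = u0 * 1); last by ring.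
  rewrite (_ : _ * (2 `^ p * (u0 * u0 `^ (p - 1))) * _ = u0 *
    (A / Gamma (1 + gamma) * u0 `^ (p - 1) * 2 `^ p * Tb `^ gamma)); last by ring.
  by rewrite ler_pM2l.
have upq : u0 < p / (p - 1) * u0.
  by rewrite ltr_pMl// ltr_pdivlMr// mul1r ltrBlDr ltrDl.
have qq : 0 < (p - 1) `^ (p - 1) by exact: powR_gt0.
have invp : (p - 1)^-1 `^ p = ((p - 1) * (p - 1) `^ (p - 1))^-1.
  by rewrite mulr_powRB1 ?(ltW q0)// -powR_inv1 ?(ltW q0)// -powRrM mulN1r powRN.
have := lower _ upq; rewrite powRM ?(ltW u0_gt0) ?divr_ge0 ?(ltW p0) ?(ltW q0)//.
rewrite u0pE powRM ?invr_ge0 ?(ltW p0) ?(ltW q0)// invp.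
rewrite (_ : p / (p - 1) * u0 - u0 = u0 / (p - 1) * 1); last by field; rewrite gt_eqF.
rewrite (_ : _ * _ * Tb `^ gamma = u0 / (p - 1) * (A / Gamma (1 + gamma) * u0 `^ (p - 1) *
   (p `^ p / (p - 1) `^ (p - 1)) * Tb `^ gamma)); last by field; rewrite !gt_eqF.
by rewrite ler_pM2l// divr_gt0.
Qed.

Lemma blow_up_time_le :
  Tb <= (Gamma (1 + gamma) / (A * u0 `^ (p - 1) * H_const p gamma)) `^ gamma^-1.
Proof.
have [_ [u [[sol _] uoo]]] := bTb; have [cu ugt0 _] := sol.
have volt := power_solution_volterra gamma01 A0 (ltW p0) u0_gt0 sol.
have u00 := power_solution0 T0 sol.
rewrite /H_const; case: (leP (p - 1)) => _; last first.
  have := blow_up_le_barrier gamma01 c0 p1 u0_gt0 T0 cu u00 ugt0 volt.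
  rewrite CE => H; apply: blow_up_le_of => //.
  have u0q' : u0 `^ (1 - p) = (u0 `^ (p - 1))^-1 by rewrite -powRN opprB.
  rewrite (_ : _ * _ = u0 `^ (p - 1) * ((p - 1) * (A / Gamma (1 + gamma)) * Tb `^ gamma)); last by ring.
  by rewrite mulrC -ler_pdivlMr// mul1r -u0q'.
set h := 2 `^ _.
have h0 : 0 < h by exact: powR_gt0.
have X0 : 0 < Gamma (1 + gamma) / (A * u0 `^ (p - 1) * h) by rewrite divr_gt0// !mulr_gt0.
apply: (blow_up_le_doubling gamma01 c0 p1 u0_gt0 cu u00 ugt0 volt).
  exact: powR_gt0.
rewrite root_powR ?(ltW X0)// CE.
rewrite [leRHS](_ : _ = h^-1); last by field; rewrite !gt_eqF.
by rewrite /h -powRN opprK.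
Qed.

End BlowUpTime.

(** * Limits as the order tends to 0 *)

Section VanishingOrder.
Context {R : realType}.

(** exp x >= 1 + x at x = ln 2 / gamma. *)
Lemma ln2_div_le (gamma : R) : 0 < gamma -> ln 2 / gamma <= 2 `^ gamma^-1.
Proof.
move=> g0; rewrite /powR pnatr_eq0/= mulrC.
by rewrite (le_trans _ (expR_ge1Dx _))// lerDr.
Qed.

Lemma cvg_pinfty_of_root (Tb : R -> R) :
  (forall gamma, 0 < gamma < 1 -> 2 `^ gamma^-1 <= Tb gamma) ->
  Tb gamma @[gamma --> 0^'+] --> +oo.
Proof.
move=> HT; have ln2 : 0 < ln 2 :> R by rewrite ln_gt0// ltr1n.
apply/cvgryPge => B; near=> g.
have g0 : 0 < g by near: g; exact: nbhs_right_gt.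
have g1 : g < 1 by near: g; exact: nbhs_right_lt.
apply: le_trans (HT g _); last by rewrite g0.
apply: le_trans (ln2_div_le g0).
have B0 : 0 < `|B| + 1 by rewrite ltr_wpDl.
rewrite ler_pdivlMr// (le_trans (_ : _ <= (`|B| + 1) * g))//.
  by rewrite ler_wpM2r ?ltW// ltr_pwDr// ler_norm.
rewrite mulrC -ler_pdivlMr// ltW//.
by near: g; apply: nbhs_right_lt; rewrite divr_gt0// ltr_wpDl.
Unshelve. all: by end_near. Qed.

Lemma cvg0_of_root (Tb : R -> R) :
  (forall gamma, 0 < gamma < 1 -> 0 <= Tb gamma <= 2^-1 `^ gamma^-1) ->
  Tb gamma @[gamma --> 0^'+] --> (0 : R).
Proof.
move=> HT; have ln2 : 0 < ln 2 :> R by rewrite ln_gt0// ltr1n.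
apply/cvgr0Pnorm_le => e e0; near=> g.
have g0 : 0 < g by near: g; exact: nbhs_right_gt.
have g1 : g < 1 by near: g; exact: nbhs_right_lt.
have /HT/andP[T0 T1] : 0 < g < 1 by rewrite g0.
rewrite ger0_norm// (le_trans T1)// -powR_inv1// -powRrM mulN1r powRN.
rewrite -[e]invrK lef_pV2 ?posrE ?powR_gt0 ?invr_gt0//.
apply: le_trans (ln2_div_le g0); rewrite ler_pdivlMr// ler_pdivrMl// ltW//.
by near: g; apply: nbhs_right_lt; rewrite mulr_gt0.
Unshelve. all: by end_near. Qed.

End VanishingOrder.

Unset Implicit Arguments.

Theorem theorem5p3 (R : realType) (A p : R) (hA : 0 < A) (hp : 1 < p) :
  (forall gamma u0 Tb : R, 0 < gamma < 1 -> 0 < u0 ->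
     blow_up_time gamma A p u0 Tb ->
     (Gamma (1 + gamma) / (A * u0 `^ (p - 1) * G_const p)) `^ (gamma^-1) <= Tb
     /\ Tb <= (Gamma (1 + gamma) / (A * u0 `^ (p - 1) * H_const p gamma))
               `^ (gamma^-1))
  /\
  (exists u01 u02 : R,
     [/\ 0 < u01, u01 < u02,
         (forall (u0 : R) (Tb : R -> R), 0 < u0 < u01 ->
            (forall gamma : R, 0 < gamma < 1 ->
               blow_up_time gamma A p u0 (Tb gamma)) ->
            Tb gamma @[gamma --> 0^'+] --> +oo) &
         (forall (u0 : R) (Tb : R -> R), u02 < u0 ->
            (forall gamma : R, 0 < gamma < 1 ->
               blow_up_time gamma A p u0 (Tb gamma)) ->
            Tb gamma @[gamma --> 0^'+] --> (0 : R))]).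
Proof.
split=> [gamma u0 Tb gamma01 u0_gt0 bTb|].
  by split; [exact: blow_up_time_ge|exact: blow_up_time_le].
have q0 : 0 < p - 1 by rewrite subr_gt0.
have G0 := G_const_gt0 hp.
pose a := expR (- 1) / (2 * (A * G_const p)).
pose h : R := 2 `^ (- (p / (p - 1))).
pose b := 4 / (A * h).
have a0 : 0 < a by rewrite divr_gt0 ?expR_gt0// !mulr_gt0.
have h0 : 0 < h by exact: powR_gt0.
have b0 : 0 < b by rewrite divr_gt0// mulr_gt0.
have root_q (x : R) : 0 <= x -> (x `^ (p - 1)^-1) `^ (p - 1) = x.
  by move=> x0; rewrite -powRrM mulVf ?gt_eqF// powRr1.
pose u01 := a `^ (p - 1)^-1.
pose u02 := u01 + 1 + b `^ (p - 1)^-1.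
have u01_gt0 : 0 < u01 by exact: powR_gt0.
exists u01, u02; split => //.
- by rewrite /u02 -addrA ltrDl ltr_wpDr// powR_ge0.
- move=> u0 Tb /andP[u0_gt0 u0_lt] bTb; apply: cvg_pinfty_of_root => gamma gamma01.
  have /andP[g0 _] := gamma01.
  apply: le_trans (blow_up_time_ge hA hp gamma01 u0_gt0 (bTb _ gamma01)).
  have u0q : 0 < u0 `^ (p - 1) by exact: powR_gt0.
  have d0 : 0 < A * u0 `^ (p - 1) * G_const p by rewrite !mulr_gt0.
  have u0a : u0 `^ (p - 1) <= a.
    by rewrite -(root_q a (ltW a0)) ge0_ler_powR ?nnegrE ?(ltW q0) ?(ltW u0_gt0) ?(ltW u01_gt0) ?(ltW u0_lt).
  rewrite ge0_ler_powR ?nnegrE ?invr_ge0 ?(ltW g0)//.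
    by rewrite divr_ge0 ?(ltW d0)// ltW// Gamma_gt0// addr_gt0.
  rewrite ler_pdivlMr// (le_trans _ (Gamma_ge_expRN1 _)) ?lerDl ?(ltW g0)//.
  move: u0a; rewrite /a ler_pdivlMr ?mulr_gt0//; apply: le_trans.
  by rewrite le_eqVlt; apply/orP; left; apply/eqP; ring.
- move=> u0 Tb u0_gt bTb; apply: cvg0_of_root => gamma gamma01.
  have /andP[g0 g1] := gamma01.
  have u0_gt0 : 0 < u0.
    by rewrite (lt_trans _ u0_gt)// /u02 !addr_gt0 ?powR_gt0.
  rewrite ltW /=; last by case: (bTb _ gamma01).
  apply: le_trans (blow_up_time_le hA hp gamma01 u0_gt0 (bTb _ gamma01)) _.
  have u0q : 0 < u0 `^ (p - 1) by exact: powR_gt0.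
  have H0 := H_const_gt0 gamma hp.
  have d0 : 0 < A * u0 `^ (p - 1) * H_const p gamma by rewrite !mulr_gt0.
  have hH : h <= H_const p gamma.
    rewrite le_max; apply/orP; right; rewrite /h ler_powR ?ler1n// lerN2.
    rewrite ler_pM2r ?invr_gt0// ger_pMr ?(lt_trans _ hp)//; exact: ltW.
  have bu0 : b <= u0 `^ (p - 1).
    rewrite -(root_q b (ltW b0)) ge0_ler_powR ?nnegrE ?(ltW q0) ?powR_ge0 ?(ltW u0_gt0)//.
    by rewrite (le_trans _ (ltW u0_gt))// /u02 lerDr addr_ge0 ?(ltW u01_gt0).
  rewrite ge0_ler_powR ?nnegrE ?invr_ge0 ?(ltW g0)//.
    by rewrite divr_ge0 ?(ltW d0)// ltW// Gamma_gt0// addr_gt0.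
  rewrite ler_pdivrMr// addrC (le_trans (GammaS_le2 _)) ?g0 ?(ltW g1)//.
  have : 4 <= A * u0 `^ (p - 1) * H_const p gamma; last by lra.
  apply: (@le_trans _ _ (u0 `^ (p - 1) * (A * h))).
    by move: bu0; rewrite /b ler_pdivrMr// mulr_gt0.
  by rewrite mulrCA mulrA ler_wpM2l// mulr_ge0 ?ltW.
Qed.
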